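(* Let $W$ be a Coxeter group, decomposed as $W=W_{\mathrm{gen}}\times W_{\mathrm{aff}}\times W_{\mathrm{sph}}$, and let $H$ be a normal subgroup of $W$. (1) $H$ is finite if and only if $H$ is a subgroup of $W_{\mathrm{sph}}$. (2) $H$ is narrow if and only if $H$ is a subgroup of $W_{\mathrm{aff}}\times W_{\mathrm{sph}}$.
   Context: A group is narrow if it contains no subgroup isomorphic to the free group $F_2$ of rank $2$. Let $S$ be a finite set and $M=(m_{s,t})_{s,t\in S}$ a Coxeter matrix ($m_{s,s}=1$, $m_{s,t}=m_{t,s}\in\{2,3,\dots\}\cup\{\infty\}$ for $s\neq t$). The Coxeter group is $W=\langle S\mid s^2=1\ (s\in S),\ (st)^{m_{s,t}}=1\ (s\neq t,\ m_{s,t}\neq\infty)\rangle$. The Coxeter graph $\Gamma$ has vertex set $S$, with an edge between $s\neq t$ iff $m_{s,t}\neq 2$. For $X\subseteq S$, $W_X$ denotes the subgroup generated by $X$. If $X_1,\dots,X_\ell$ are the vertex sets of the connected components of $\Gamma$, then $W=W_{X_1}\times\cdots\times W_{X_\ell}$; the $W_{X_i}$ are the irreducible components. On $V=\bigoplus_{s\in S}\mathbb{R}\alpha_s$ the canonical form is the symmetric bilinear form with $\langle\alpha_s\mid\alpha_t\rangle=-\cos(\pi/m_{s,t})$ if $m_{s,t}\neq\infty$ and $-1$ otherwise. An irreducible Coxeter group (connected $\Gamma$) is of spherical type if its canonical form is positive definite (equivalently, it is finite), of affine type if the form is positive semidefinite but not positive definite, and generic otherwise. $W_{\mathrm{gen}}$,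 $W_{\mathrm{aff}}$, $W_{\mathrm{sph}}$ are the products of the generic, affine, and spherical irreducible components respectively, so $W=W_{\mathrm{gen}}\times W_{\mathrm{aff}}\times W_{\mathrm{sph}}$. *)

(* Defs.v *)
From Stdlib Require Import Reals.
From mathcomp Require Import all_boot all_order all_algebra.
From mathcomp Require Import Rstruct.
Set Implicit Arguments. Unset Strict Implicit. Unset Printing Implicit Defensive.

Section Coxeter.
Variable S : finType.
(* Coxeter matrix; convention: the entry 0 encodes m_{s,t} = infinity. *)
Variable m : S -> S -> nat.

Definition coxeter_matrix : Prop :=
  [/\ forall s, m s s = 1%N,
      forall s t, m s t = m t s &
      forall s t, s != t -> m s t != 1%N].

(* Words over S; the Coxeter group W is the set of words modulo the smallest
   congruence [coxeq] generated by the defining relators s^2 and (st)^{m_{s,t}}. *)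
Inductive coxeq : seq S -> seq S -> Prop :=
| coxeq_refl u : coxeq u u
| coxeq_sym u v : coxeq u v -> coxeq v u
| coxeq_trans u v w : coxeq u v -> coxeq v w -> coxeq u w
| coxeq_ctx a b u v : coxeq u v -> coxeq (a ++ u ++ b) (a ++ v ++ b)
| coxeq_sq s : coxeq [:: s; s] [::]
| coxeq_braid s t : m s t != 0%N ->
    coxeq (flatten (nseq (m s t) [:: s; t])) [::].

(* Group operations on representatives: product = concatenation,
   inverse = reversal (generators are involutions), identity = [::]. *)
Definition winv (u : seq S) : seq S := rev u.

Definition normal_subgroup (H : seq S -> Prop) : Prop :=
  [/\ forall u v, coxeq u v -> H u -> H v,
      H [::],
      forall u v, H u -> H v -> H (u ++ v),
      forall u, H u -> H (winv u) &
      forall u g, H u -> H (winv g ++ u ++ g)].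

Definition finite_sub (H : seq S -> Prop) : Prop :=
  exists l : seq (seq S), forall u, H u -> exists2 v, v \in l & coxeq u v.

Definition sub_parabolic (H : seq S -> Prop) (P : S -> Prop) : Prop :=
  forall u, H u -> exists v, (forall s, s \in v -> P s) /\ coxeq u v.

(* Free group F_2 on {a, b}: letters (x, e) with x = false for a, true for b,
   and e = true for the inverse letter. Reduced words: no x^e x^{-e}. *)
Fixpoint reduced2 (w : seq (bool * bool)) : bool :=
  match w with
  | x :: ((y :: _) as w') => ~~ ((x.1 == y.1) && (x.2 != y.2)) && reduced2 w'
  | _ => true
  end.

Definition eval2 (u v : seq S) (w : seq (bool * bool)) : seq S :=
  flatten [seq (let g := if l.1 then v else u in if l.2 then winv g else g) | l <- w].

Definition free_pair (u v : seq S) : Prop :=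
  forall w, w != [::] -> reduced2 w -> ~ coxeq (eval2 u v w) [::].

Definition narrow (H : seq S -> Prop) : Prop :=
  ~ exists u v, [/\ H u, H v & free_pair u v].

Definition cform (s t : S) : R :=
  if m s t == 0%N then Ropp R1 else Ropp (cos (Rdiv PI (INR (m s t)))).

Definition cgraph : rel S := fun s t => (s != t) && (m s t != 2%N).
Definition comp (s : S) : pred S := fun t => connect cgraph s t.

Local Open Scope ring_scope.
Definition qform (X : pred S) (x : S -> R) : R :=
  \sum_(i in X) \sum_(j in X) x i * x j * cform i j.

Definition pos_def (X : pred S) : Prop :=
  forall x : S -> R, (exists2 t, t \in X & x t != 0) -> 0 < qform X x.
Definition pos_semidef (X : pred S) : Prop :=
  forall x : S -> R, 0 <= qform X x.

Definition is_sph (s : S) : Prop := pos_def (comp s).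
Definition is_aff (s : S) : Prop := pos_semidef (comp s) /\ ~ pos_def (comp s).
Definition is_gen (s : S) : Prop := ~ pos_semidef (comp s).
End Coxeter.

(* Main.v *)
Require Import Defs.
From Stdlib Require Import Reals.
From mathcomp Require Import all_boot all_order all_algebra.
From mathcomp Require Import Rstruct.
From mathcomp Require Import boolp reals zify ring lra.
Set Implicit Arguments. Unset Strict Implicit. Unset Printing Implicit Defensive.
Import Order.TTheory GRing.Theory Num.Theory.
Local Open Scope ring_scope.

(** Everything takes place in the geometric representation, which is faithful by Tits' theorem.
On a component which is not spherical, Perron-Frobenius produces a vector [z] that is positive
on the component and pairs nonpositively with the simple roots (negatively in the generic case).

If [H] is finite, summing the pullbacks of a positive functional over [H] gives an [H]-invariant
functional that is positive at [z]. Normality and connectedness then make every [<.|a_s>]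
invariant, so that [H] acts unipotently, hence trivially, on the component.

If [H] acts nontrivially on a generic component, it moves some simple root [b1] to a root having
an arbitrarily large product with [b1]; up to sign this gives a root [b2] with [<b1|b2> < -1], and
the product [r1 r2] of the two reflections is in [H] by normality. A third root having
negative products with both isotropic axes of [r1 r2], moved by powers of [r1 r2], yields three roots with pairwise products at most [-1],
and [r1 r2] together with its conjugate by the third reflection plays ping-pong.

Conversely, when the form is positive semidefinite, the displacements of a functional have norm
at most linear in the word length and are uniformly separated: this gives polynomial growth, so no
free pair, and finiteness in the definite case. *)

(** * Reflections and the geometric representation *)

(** The form may be degenerate or indefinite, so vectors have no length to rely on. The substitute
    is the coordinate sum, which is at least 1 on every positive root; it turns bounds on vectors
    into bounds on word length, and thereby makes images of [H] finite. Large products of roots are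
    reached indirectly. If the products [<h a_s|a_s>] stayed bounded for [h] in [H], so would
    [<h z|z>], because the squares of the simple roots together with normality control the whole
    symmetric square. But [<h z|z>] decreases at least linearly in the number of letters of the
    component in a reduced word for [h], so only finitely many actions on the component would
    remain, and the argument for finite [H] would make [H] act trivially there. *)

Section Form.
Variables (R : realType) (S : finType) (B : S -> S -> R).
Local Notation V := {ffun S -> R}.
Implicit Types (v w x y b : V) (s t i j : S) (X Y : pred S) (u : seq S).

Definition scalev (a : R) v : V := [ffun i => a * v i].
Definition sroot s : V := [ffun i => (i == s)%:R].
Definition bform v w : R := \sum_i \sum_j v i * w j * B i j.
Definition refl b v : V := v - scalev (2 * bform v b) b.
Definition act u v : V := foldr (fun s => refl (sroot s)) v u.
Definition supp X v := forall i, i \notin X -> v i = 0.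
Definition nonneg v := forall i, 0 <= v i.

(** The matrix is abstract: the linear algebra uses these four properties of the canonical form and
    mentions neither the orders [m s t] nor cosines. *)
Record cartan : Prop := Cartan {
  cartan_sym : forall s t, B s t = B t s;
  cartan_diag : forall s, B s s = 1;
  cartan_le0 : forall s t, s != t -> B s t <= 0;
  cartan_geN1 : forall s t, -1 <= B s t }.

Lemma bformDl x y w : bform (x + y) w = bform x w + bform y w.
Proof.
rewrite /bform -big_split; apply: eq_bigr => i _ /=.
by rewrite -big_split; apply: eq_bigr => j _ /=; rewrite ffunE !mulrDl.
Qed.

Lemma bformZl a x w : bform (scalev a x) w = a * bform x w.
Proof.
rewrite /bform mulr_sumr; apply: eq_bigr => i _.
by rewrite mulr_sumr; apply: eq_bigr => j _; rewrite ffunE -!mulrA.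
Qed.

Lemma scaleN1v x : scalev (-1) x = - x.
Proof. by apply/ffunP => i; rewrite !ffunE mulN1r. Qed.

Lemma scale1v x : scalev 1 x = x.
Proof. by apply/ffunP => i; rewrite !ffunE mul1r. Qed.

Lemma scale0v x : scalev 0 x = 0.
Proof. by apply/ffunP => i; rewrite !ffunE mul0r. Qed.

Lemma bformNl x w : bform (- x) w = - bform x w.
Proof. by rewrite -scaleN1v bformZl mulN1r. Qed.

Lemma bformBl x y w : bform (x - y) w = bform x w - bform y w.
Proof. by rewrite bformDl bformNl. Qed.

Lemma bform0l w : bform 0 w = 0.
Proof. by rewrite -(scale0v 0) bformZl mul0r. Qed.

Lemma vec_decomp v : v = \sum_s scalev (v s) (sroot s).
Proof.
apply/ffunP => i; rewrite sum_ffunE (bigD1 i) //= big1 ?addr0.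
  by rewrite !ffunE eqxx mulr1.
by move=> j ne; rewrite !ffunE eq_sym (negbTE ne) mulr0.
Qed.

Lemma bform_suml (I : Type) (r : seq I) (P : pred I) (F : I -> V) w :
  bform (\sum_(k <- r | P k) F k) w = \sum_(k <- r | P k) bform (F k) w.
Proof.
elim/big_rec2: _ => [|k a b _ <-]; first exact: bform0l.
by rewrite bformDl.
Qed.

Lemma bformEl v w : bform v w = \sum_s v s * bform (sroot s) w.
Proof.
by rewrite [in LHS](vec_decomp v) bform_suml; apply: eq_bigr => s _; rewrite bformZl.
Qed.

Lemma suppD X v w : supp X v -> supp X w -> supp X (v + w).
Proof. by move=> hv hw i hi; rewrite ffunE hv // hw // addr0. Qed.

Lemma suppZ X a v : supp X v -> supp X (scalev a v).
Proof. by move=> hv i hi; rewrite ffunE hv // mulr0. Qed.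

Lemma suppN X v : supp X v -> supp X (- v).
Proof. by move=> hv i hi; rewrite ffunE hv // oppr0. Qed.

Lemma suppB X v w : supp X v -> supp X w -> supp X (v - w).
Proof. by move=> hv hw; apply: suppD => //; apply: suppN. Qed.

Lemma supp0 X : supp X 0.
Proof. by move=> i _; rewrite ffunE. Qed.

Lemma supp_sroot X s : s \in X -> supp X (sroot s).
Proof. by move=> hs i hi; rewrite ffunE; case: eqP => // e; rewrite e hs in hi. Qed.

Lemma bformEX X v w : supp X v -> bform v w = \sum_(s in X) v s * bform (sroot s) w.
Proof.
move=> hv; rewrite bformEl (bigID [in X]) /= [X in _ + X]big1 ?addr0 //.
by move=> s hs; rewrite hv // mul0r.
Qed.

Lemma bform_sroot s t : bform (sroot s) (sroot t) = B s t.
Proof.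
rewrite /bform (bigD1 s) //= [X in _ + X]big1 ?addr0; last first.
  by move=> i ne; apply: big1 => j _; rewrite ffunE (negbTE ne) !mul0r.
rewrite (bigD1 t) //= [X in _ + X]big1 ?addr0.
  by rewrite !ffunE !eqxx !mul1r.
by move=> i ne; rewrite !ffunE (negbTE ne) mulr0 mul0r.
Qed.

Lemma bform_symm v w : (forall s t, B s t = B t s) -> bform v w = bform w v.
Proof.
move=> symB; rewrite /bform exchange_big; apply: eq_bigr => i _; apply: eq_bigr => j _.
by rewrite symB [v j * _]mulrC.
Qed.

Hypothesis HB : cartan.

Lemma bformC v w : bform v w = bform w v.
Proof. exact/bform_symm/(cartan_sym HB). Qed.

Lemma bformDr x y w : bform w (x + y) = bform w x + bform w y.
Proof. by rewrite bformC bformDl !(bformC w). Qed.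
Lemma bformZr a x w : bform w (scalev a x) = a * bform w x.
Proof. by rewrite bformC bformZl !(bformC w). Qed.
Lemma bformNr x w : bform w (- x) = - bform w x.
Proof. by rewrite bformC bformNl !(bformC w). Qed.
Lemma bformBr x y w : bform w (x - y) = bform w x - bform w y.
Proof. by rewrite bformC bformBl !(bformC w). Qed.
Definition bformE :=
  (bformDl, bformDr, bformBl, bformBr, bformZl, bformZr, bformNl, bformNr).

Lemma bform_rootrr s : bform (sroot s) (sroot s) = 1.
Proof. by rewrite bform_sroot (cartan_diag HB). Qed.

Lemma reflD b x y : refl b (x + y) = refl b x + refl b y.
Proof. by apply/ffunP => i; rewrite !ffunE bformDl; ring. Qed.
Lemma reflZ b a x : refl b (scalev a x) = scalev a (refl b x).
Proof. by apply/ffunP => i; rewrite !ffunE bformZl; ring. Qed.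

Lemma reflb b : bform b b = 1 -> refl b b = - b.
Proof. by move=> e; apply/ffunP => i; rewrite !ffunE e; ring. Qed.

Lemma reflNb b x : refl (- b) x = refl b x.
Proof. by apply/ffunP => i; rewrite !ffunE !bformE; ring. Qed.

Lemma reflK b v : bform b b = 1 -> refl b (refl b v) = v.
Proof. by move=> e; apply/ffunP => i; rewrite !ffunE !bformE e; ring. Qed.

Lemma refl_fix b v : bform v b = 0 -> refl b v = v.
Proof. by move=> e; apply/ffunP => i; rewrite !ffunE e; ring. Qed.

Lemma bform_refl b v w : bform b b = 1 -> bform (refl b v) (refl b w) = bform v w.
Proof. by move=> e; rewrite !bformE e (bformC b w); ring. Qed.

Lemma bform_refll b v w : bform (refl b v) w = bform v w - 2 * bform v b * bform b w.
Proof. by rewrite !bformE. Qed.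

Lemma act_cat u1 u2 v : act (u1 ++ u2) v = act u1 (act u2 v).
Proof. by rewrite /act foldr_cat. Qed.

Lemma act_rcons u s v : act (rcons u s) v = act u (refl (sroot s) v).
Proof. by rewrite -cats1 act_cat. Qed.

Lemma actD u x y : act u (x + y) = act u x + act u y.
Proof. by elim: u => //= s u ->; rewrite reflD. Qed.
Lemma actZ u a x : act u (scalev a x) = scalev a (act u x).
Proof. by elim: u => //= s u ->; rewrite reflZ. Qed.
Lemma actN u x : act u (- x) = - act u x.
Proof. by rewrite -scaleN1v actZ scaleN1v. Qed.
Lemma actB u x y : act u (x - y) = act u x - act u y.
Proof. by rewrite actD actN. Qed.
Lemma act0 u : act u 0 = 0.
Proof. by rewrite -(scale0v 0) actZ !scale0v. Qed.
Lemma act_sum u (I : Type) (r : seq I) (P : pred I) (F : I -> V) :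
  act u (\sum_(k <- r | P k) F k) = \sum_(k <- r | P k) act u (F k).
Proof.
elim/big_rec2: _ => [|k a b _ <-]; first exact: act0.
by rewrite actD.
Qed.

Lemma bform_act u v w : bform (act u v) (act u w) = bform v w.
Proof. by elim: u => //= s u <-; rewrite bform_refl // bform_rootrr. Qed.

Lemma actK u v : act (rev u) (act u v) = v.
Proof.
elim: u v => //= s u IH v.
by rewrite rev_cons act_rcons reflK ?IH // bform_rootrr.
Qed.

Lemma actKV u v : act u (act (rev u) v) = v.
Proof. by rewrite -{1}(revK u) actK. Qed.

Lemma bform_actl u v w : bform (act u v) w = bform v (act (rev u) w).
Proof. by rewrite -(bform_act (rev u)) actK. Qed.

Lemma act_refl u b v : act u (refl b v) = refl (act u b) (act u v).
Proof. by rewrite /refl actB actZ bform_act. Qed.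

Lemma act_conj u b v : refl (act u b) v = act u (refl b (act (rev u) v)).
Proof. by rewrite act_refl actKV. Qed.

(** In terms of the Coxeter graph, no edge leaves [X]: it is a union of connected components. *)
Definition closed_part X := forall i j, i \in X -> j \notin X -> B i j = 0.

Lemma bform_root_supp X s v : closed_part X -> supp X v -> s \notin X ->
  bform v (sroot s) = 0.
Proof.
move=> hX hv hs; rewrite (bformEX _ hv) big1 // => i hi.
by rewrite bform_sroot hX // mulr0.
Qed.

Lemma refl_root_supp X s v : closed_part X -> supp X v -> supp X (refl (sroot s) v).
Proof.
move=> hX hv; case: (boolP (s \in X)) => hs.
  by apply: suppB => //; apply: suppZ; apply: supp_sroot.
by rewrite refl_fix //; apply: (bform_root_supp hX).
Qed.

Lemma supp_act X u v : closed_part X -> supp X v -> supp X (act u v).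
Proof. by move=> hX hv; elim: u => //= s u; apply: refl_root_supp. Qed.

(** A letter outside [X] fixes every vector supported in [X], so only the letters in [X] matter
    there. *)
Lemma act_filter X u v : closed_part X -> supp X v -> act (filter X u) v = act u v.
Proof.
move=> hX hv; elim: u => //= s u IH; case: ifP => [hs /=|hs]; rewrite IH //.
rewrite refl_fix //; apply: (bform_root_supp hX); last by rewrite -topredE /= hs.
exact: supp_act.
Qed.

End Form.

(** * Reduced words and Tits' theorem *)

Section Words.
Variables (S : finType) (m : S -> S -> nat).
Local Notation "u ~ v" := (coxeq m u v) (at level 70).
Implicit Types (s t : S) (u v w x : seq S).

Lemma coxeq_cat u u' v v' : u ~ u' -> v ~ v' -> u ++ v ~ u' ++ v'.
Proof.
move=> hu hv; apply: (@coxeq_trans _ _ _ (u' ++ v)).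
  by have := coxeq_ctx [::] v hu.
by have := coxeq_ctx u' [::] hv; rewrite !cats0.
Qed.

Lemma coxeq_catl u v v' : v ~ v' -> u ++ v ~ u ++ v'.
Proof. by apply: coxeq_cat; apply: coxeq_refl. Qed.

Lemma coxeq_catr u u' v : u ~ u' -> u ++ v ~ u' ++ v.
Proof. by move=> h; apply: coxeq_cat => //; apply: coxeq_refl. Qed.

Lemma coxeq_revK u : u ++ rev u ~ [::].
Proof.
elim: u => [|s u IH]; first exact: coxeq_refl.
have -> : (s :: u) ++ rev (s :: u) = [:: s] ++ (u ++ rev u) ++ [:: s].
  by rewrite rev_cons -cats1 /= catA.
exact: coxeq_trans (coxeq_ctx [:: s] [:: s] IH) (coxeq_sq m s).
Qed.

Lemma coxeq_revKV u : rev u ++ u ~ [::].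
Proof. by have := coxeq_revK (rev u); rewrite revK. Qed.

Lemma coxeq_cancel u v w : u ++ v ~ u ++ w -> v ~ w.
Proof.
move=> /(coxeq_catl (rev u)); rewrite !catA => h.
have k x : x ~ (rev u ++ u) ++ x.
  by apply: coxeq_sym; have := coxeq_catr x (coxeq_revKV u).
exact: coxeq_trans (k v) (coxeq_trans h (coxeq_sym (k w))).
Qed.

Lemma coxeq_cat_nil u v : u ++ v ~ [::] -> v ~ rev u.
Proof.
move=> h; apply: (@coxeq_cancel u); apply: coxeq_trans h _.
exact/coxeq_sym/coxeq_revK.
Qed.

(** All defining relators have even length. *)
Lemma coxeq_parity u v : u ~ v -> odd (size u) = odd (size v).
Proof.
elim=> [||a b c _ -> _ ->|a b c d _ e||s t _] //=; first by rewrite !size_cat !oddD e.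
by elim: (m s t) => //= n ->.
Qed.

Definition reduced_word u := forall v, u ~ v -> (size u <= size v)%N.

Lemma exists_reduced u : exists2 v, u ~ v & reduced_word v.
Proof.
have [n] := ubnP (size u); elim: n u => [|n IH] u; first by [].
move=> /ltnSE le; have [h|] := EM (reduced_word u); first by exists u => //; apply: coxeq_refl.
move=> /existsNP[v] /not_implyP[uv /negP]; rewrite -ltnNge => lt.
have [w vw hw] := IH v (leq_trans lt le); exists w => //.
exact: coxeq_trans vw.
Qed.

Lemma reduced_sub a u b : reduced_word (a ++ u ++ b) -> reduced_word u.
Proof.
move=> h v uv; have := h _ (coxeq_ctx a b uv).
by rewrite !size_cat leq_add2l leq_add2r.
Qed.

Lemma reduced_catl a u : reduced_word (a ++ u) -> reduced_word a.
Proof. by move=> h; apply: (@reduced_sub [::] a u). Qed.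

Lemma reduced_catr a u : reduced_word (a ++ u) -> reduced_word u.
Proof. by move=> h; apply: (@reduced_sub a u [::]); rewrite cats0. Qed.

Lemma reduced_eq_size u v : reduced_word u -> u ~ v -> size u = size v -> reduced_word v.
Proof. by move=> h uv e w vw; rewrite -e; apply: h; apply: coxeq_trans vw. Qed.

(** The alternating word of length [k] whose last letter is [t]. It is built from the right end, the
    letter that acts first on a vector. *)
Fixpoint altw s t k : seq S := if k is k'.+1 then rcons (altw t s k') t else [::].

Lemma size_altw s t k : size (altw s t k) = k.
Proof. by elim: k s t => //= k IH s t; rewrite size_rcons IH. Qed.

Lemma altw_split a b s t : exists P, altw s t (a + b) = P ++ altw s t b /\ size P = a.
Proof.
elim: b s t => [|b IH] s t.
  by exists (altw s t a); rewrite addn0 cats0 size_altw.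
have [P [e h]] := IH t s; exists P; split => //.
by rewrite addnS /= e rcons_cat.
Qed.

Lemma altw_flatten s t n : altw s t (n + n) = flatten (nseq n [:: s; t]).
Proof.
elim: n => // n IH; rewrite addSn addnS /= IH -!cats1 -catA /=.
by elim: n {IH} => // n /= ->.
Qed.

(** Cutting the relator of length [2m] after [m - 1] letters shows that the remaining [m + 1]
    letters equal a word of length [m - 1]. *)
Lemma altw_not_reduced s t : m s t != 0%N -> ~ reduced_word (altw s t (m s t).+1).
Proof.
move=> h0 red; have hb := coxeq_braid h0; case: (m s t) hb h0 red => // n + _ red.
rewrite -altw_flatten addSnnS => h; have [P [e hP]] := altw_split n n.+2 s t.
move: h; rewrite e => /coxeq_cat_nil /red.
by rewrite size_altw size_rev hP ltnNge leqnSn.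
Qed.

(** Appending a letter changes the length by at most one, and parity excludes that it stays the
    same. *)
Lemma not_reduced_rcons u s : reduced_word u -> ~ reduced_word (rcons u s) ->
  exists v, [/\ rcons u s ~ v, reduced_word v & (size v).+1 = size u].
Proof.
move=> hu hns; have [v uv hv] := exists_reduced (rcons u s); exists v; split => //.
have le : (size v <= (size u).+1)%N by have := hv _ (coxeq_sym uv); rewrite size_rcons.
have par := coxeq_parity uv; rewrite size_rcons /= in par.
have ge : (size u <= (size v).+1)%N.
  rewrite -(size_rcons v s); apply: hu; rewrite -cats1.
  apply: (@coxeq_trans _ _ _ (rcons u s ++ [:: s])); last exact: coxeq_catr.
  rewrite -cats1 -catA -[X in X ~ _]cats0; apply: coxeq_catl.
  exact/coxeq_sym/coxeq_sq.
move: le; rewrite leq_eqVlt => /orP[/eqP e|].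
  by case: hns; apply: reduced_eq_size hv (coxeq_sym uv) _; rewrite size_rcons.
rewrite ltnS leq_eqVlt => /orP[/eqP e|lt]; first by rewrite e in par; case: (odd _) par.
by apply/eqP; rewrite eqn_leq lt ge.
Qed.

Lemma reduced_altw s t x : reduced_word (rcons x s) -> all (pred2 s t) x ->
  x = altw s t (size x).
Proof.
elim/last_ind: x s t => // x a IH s t red.
rewrite all_rcons size_rcons /= => /andP[/orP[]/eqP ea hx].
  have /reduced_catr h : reduced_word (x ++ [:: s; s]).
    by rewrite -cat_rcons cats1 -[in rcons x _]ea.
  by have := h [::] (coxeq_sq m s).
congr rcons => //; apply: IH.
  by rewrite -ea; apply: (@reduced_catl _ [:: s]); rewrite cats1.
by apply: sub_all hx => b /=; rewrite orbC.
Qed.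

End Words.

Section Chebyshev.
Variable (R : realType).
(** Chebyshev polynomials of the second kind, shifted by one: [cheb c k] is [U_(k-1)(c)], that is
    [sin (k th) / sin th] for [c = cos th]. *)
Fixpoint cheb (c : R) (k : nat) : R :=
  if k is k'.+1 then if k' is k''.+1 then 2 * c * cheb c k' - cheb c k'' else 1 else 0.
#[global] Arguments cheb : simpl never.
Lemma cheb0 c : cheb c 0 = 0. Proof. by []. Qed.
Lemma cheb1 c : cheb c 1 = 1. Proof. by []. Qed.
Lemma chebSS c k : cheb c k.+2 = 2 * c * cheb c k.+1 - cheb c k.
Proof. by []. Qed.
End Chebyshev.

Section Tits.
Variables (R : realType) (S : finType) (m : S -> S -> nat) (B : S -> S -> R).
Local Notation V := {ffun S -> R}.
Local Notation "u ~ v" := (coxeq m u v) (at level 70).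
Implicit Types (s t : S) (u v w x : seq S).
Local Notation act := (act B).

(** The only trigonometric input of Tits' theorem. For [- B s t = cos (pi / m)] the value of [cheb]
    at [k] is [sin (k pi / m) / sin (pi / m)], whence the values at [2m] and [2m + 1] and the sign
    up to [m]. The guard in [cf_cheb_ge0] lets [k] be arbitrary when [m s t] is infinite. *)
Record coxeter_form : Prop := CoxeterForm {
  cf_cartan :> cartan B;
  cf_diag : forall s, m s s = 1%N;
  cf_sym : forall s t, m s t = m t s;
  cf_lt1 : forall s t, s != t -> m s t != 0%N -> B s t ^+ 2 < 1;
  cf_cheb0 : forall s t, s != t -> m s t != 0%N -> cheb (- B s t) (m s t + m s t) = 0;
  cf_cheb1 : forall s t, s != t -> m s t != 0%N -> cheb (- B s t) (m s t + m s t).+1 = 1;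
  cf_cheb_ge0 : forall s t k, s != t -> (m s t != 0 -> k <= m s t)%N ->
    0 <= cheb (- B s t) k }.

Hypothesis HB : coxeter_form.
Let HC : cartan B := HB.

Lemma act_altw s t k : s != t -> act (altw s t k) (sroot R s) =
  if odd k then scalev (cheb (- B s t) k.+1) (sroot R t) + scalev (cheb (- B s t) k) (sroot R s)
  else scalev (cheb (- B s t) k.+1) (sroot R s) + scalev (cheb (- B s t) k) (sroot R t).
Proof.
have [n] := ubnP k; elim: n k s t => // n IH [|[|k]] s t.
- by move=> _ _ /=; rewrite cheb0 cheb1 scale1v scale0v addr0.
- move=> _ _ /=; apply/ffunP => i; rewrite !ffunE bform_sroot chebSS cheb0 cheb1; ring.
move=> /ltnSE lt ne; rewrite [altw _ _ _]/= act_rcons.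
have -> : refl B (sroot R t) (sroot R s) = scalev (2 * - B s t) (sroot R t) + sroot R s.
  by apply/ffunP => i; rewrite !ffunE bform_sroot; ring.
rewrite -[rcons _ _]/(altw t s k.+1) actD actZ IH 1?eq_sym // [altw _ _ _]/=.
rewrite act_rcons (reflb (bform_rootrr HC s)) actN IH 1?ltnW //= negbK (cartan_sym HC t s); case: (odd k) => /=;
by apply/ffunP => i; rewrite !ffunE !chebSS; ring.
Qed.

(** The relator fixes the plane of the two simple roots by the Chebyshev identities, and it fixes
    the orthogonal of that plane letter by letter. As [B s t ^+ 2 < 1], the plane is nondegenerate
    and the two span everything. *)
Lemma act_braid s t (v : V) : m s t != 0%N -> act (flatten (nseq (m s t) [:: s; t])) v = v.
Proof.
move=> h0; have [<-|ne] := eqVneq s t.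
  by rewrite (cf_diag HB) /= reflK // bform_rootrr.
rewrite -altw_flatten; set k := (m s t + m s t)%N; set c := - B s t.
have hs : act (altw s t k) (sroot R s) = sroot R s.
  rewrite act_altw // /k oddD addbb /= (cf_cheb0 HB) // (cf_cheb1 HB) //.
  by rewrite scale1v scale0v addr0.
have ht : act (altw s t k) (sroot R t) = sroot R t.
  have [p ek hp] : exists2 p, k = p.+2 & odd p = false.
    rewrite /k; case: (m s t) h0 => // n _; exists (n + n)%N; rewrite ?oddD ?addbb //.
    by rewrite addSn addnS.
  have e0 := cf_cheb0 HB ne h0; have e1 := cf_cheb1 HB ne h0.
  rewrite -/k -/c ek in e0 e1; rewrite chebSS e0 mulr0 sub0r in e1.
  rewrite ek [altw _ _ _]/= act_rcons (reflb (bform_rootrr HC t)) actN.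
  rewrite -[rcons _ _]/(altw t s p.+1) act_altw 1?eq_sym // (cartan_sym HC t s) -/c.
  have {}e1 : cheb c p.+1 = -1 by rewrite -e1 opprK.
  rewrite /= hp /= e0 e1.
  by apply/ffunP => i; rewrite !ffunE; ring.
have hfix (w : V) : bform B w (sroot R s) = 0 -> bform B w (sroot R t) = 0 ->
    forall n a b, (a == s) || (a == t) -> (b == s) || (b == t) -> act (altw a b n) w = w.
  move=> es et; elim=> //= n IH a b ha hb; rewrite act_rcons refl_fix ?IH //.
  by case/orP: hb => /eqP ->.
have d : 1 - c ^+ 2 != 0.
  by have := cf_lt1 HB ne h0; rewrite /c sqrrN subr_eq0 => h; rewrite gt_eqF.
set a := bform B v (sroot R s); set b := bform B v (sroot R t).
(* Orthogonal projection of [v] to the plane, from the inverse of the Gram matrix, whose determinant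
   is [1 - c ^+ 2]. *)
set p := scalev ((a + c * b) / (1 - c ^+ 2)) (sroot R s)
  + scalev ((c * a + b) / (1 - c ^+ 2)) (sroot R t).
have bst : B s t = - c by rewrite /c opprK.
have -> : v = (v - p) + p by rewrite subrK.
rewrite actD hfix ?eqxx ?orbT //; first by rewrite actD !actZ hs ht.
- rewrite /p !(bformE HC) !bform_sroot (cartan_diag HC) (cartan_sym HC t s) bst -/a; field => //.
- rewrite /p !(bformE HC) !bform_sroot (cartan_diag HC) bst -/b; field => //.
Qed.

Lemma act_coxeq u v (x : V) : u ~ v -> act u x = act v x.
Proof.
move=> h; elim: h x => {u v}.
- by [].
- by move=> u v _ IH x; rewrite IH.
- by move=> u v w _ IH _ IH' x; rewrite IH IH'.
- by move=> a b u v _ IH x; rewrite !act_cat IH.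
- by move=> s x /=; rewrite reflK // bform_rootrr.
- by move=> s t h x; rewrite act_braid.
Qed.

Lemma nonnegD (x y : V) : nonneg x -> nonneg y -> nonneg (x + y).
Proof. by move=> hx hy i; rewrite ffunE addr_ge0. Qed.
Lemma nonnegZ a (x : V) : 0 <= a -> nonneg x -> nonneg (scalev a x).
Proof. by move=> ha hx i; rewrite ffunE mulr_ge0. Qed.
Lemma nonneg_sroot s : nonneg (sroot R s).
Proof. by move=> i; rewrite ffunE ler0n. Qed.

(* Tits: a reduced word [u] is split, up to [coxeq], as [v ++ x] with [x] in the letters
   [s], [t] and [v] as short as possible; then [v] keeps both simple roots positive, while
   [x] is alternating and its action on the simple root of [s] is given by Chebyshev
   polynomials. *)
Lemma reduced_rcons_nonneg u s : reduced_word m (rcons u s) -> nonneg (act u (sroot R s)).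
Proof.
have [n] := ubnP (size u); elim: n u s => // n IH u s /ltnSE le.
case: (lastP u) le => [_ _|u' t le red]; first exact: nonneg_sroot.
have red' : reduced_word m (rcons u' t).
  by apply: (@reduced_catl _ _ _ [:: s]); rewrite cats1.
have nst : s != t.
  apply/eqP => e; rewrite -e -!cats1 -catA in red.
  by have /(_ _ (coxeq_sq m s)) := reduced_catr red.
pose P k := exists v x, [/\ rcons u' t ~ v ++ x, all (pred2 s t) x,
  size v + size x = size (rcons u' t) & size v = k]%N.
have [k [Pk kmin]] : exists k, P k /\ forall j, P j -> (k <= j)%N.
  have : P (size u').
    exists u', [:: t]; split; rewrite ?cats1 ?size_rcons ?addn1 //=.
      exact: coxeq_refl.
    by rewrite eqxx orbT.
  move: (size u') => a; elim/ltn_ind: a => a IHa Pa.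
  have [[b [Pb lt]]|no] := EM (exists b, P b /\ (b < a)%N); first exact: IHa Pb.
  by exists a; split => // j Pj; rewrite leqNgt; apply/negP => lt; apply: no; exists j.
case: Pk => v [x [uv hx hsz hk]].
have ltk : (size v < n)%N.
  have : (k <= size u')%N.
    apply: kmin; exists u', [:: t]; split; rewrite ?cats1 ?size_rcons ?addn1 //=.
      exact: coxeq_refl.
    by rewrite eqxx orbT.
  by rewrite size_rcons in le; rewrite hk => /leq_ltn_trans; apply.
have redvx : reduced_word m (v ++ x).
  by apply: (reduced_eq_size red' uv); rewrite size_cat.
have redv := reduced_catl redvx.
(* If [v] followed by [a] were not reduced, [a] could be moved from the end of [v] to the front of
   [x], against the minimality of [v]. *)
have redv1 a : (a == s) || (a == t) -> reduced_word m (rcons v a).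
  move=> ha; apply: contrapT => /(not_reduced_rcons redv)[v' [e1 _ e2]].
  suff /kmin : P (size v') by rewrite -hk -e2 ltnn.
  exists v', (a :: x); split => //=.
  - apply: coxeq_trans uv _.
    apply: (@coxeq_trans _ _ _ (rcons v a ++ a :: x)); last exact: coxeq_catr.
    rewrite cat_rcons; apply: coxeq_catl; apply: coxeq_sym.
    exact: (coxeq_ctx [::] x (coxeq_sq m a)).
  - by rewrite ha hx.
  - by rewrite -hsz -e2 addnS addSn.
have vs : nonneg (act v (sroot R s)) by apply: IH => //; apply: redv1; rewrite eqxx.
have vt : nonneg (act v (sroot R t)) by apply: IH => //; apply: redv1; rewrite eqxx orbT.
have redxs : reduced_word m (rcons x s).
  apply: (@reduced_catr _ _ v); rewrite -rcons_cat.
  apply: (reduced_eq_size red); last by rewrite !size_rcons size_cat hsz size_rcons.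
  by rewrite -!cats1 in uv *; apply: coxeq_catr.
have ex := reduced_altw redxs hx.
(* An alternating word with more than [m s t] letters is not reduced, which keeps the Chebyshev
   index in the range of nonnegative values. *)
have lek : (m s t != 0 -> (size x).+1 <= m s t)%N.
  move=> h0; rewrite ltnNge; apply/negP => ltx; rewrite (cf_sym HB) in h0.
  apply: (altw_not_reduced h0).
  have : reduced_word m (altw t s (size x).+1) by rewrite /= -ex.
  have [Q [eQ _]] := altw_split (size x - m t s) (m t s).+1 t s.
  rewrite addnS subnK in eQ; last by rewrite (cf_sym HB).
  by rewrite eQ => /reduced_catr.
rewrite (act_coxeq _ uv) act_cat ex act_altw //.
case: ifP => _; rewrite actD !actZ; apply: nonnegD; apply: nonnegZ => //;
apply: (cf_cheb_ge0 HB) => //; move/lek => //; apply: leq_trans; exact: leqnSn.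
Qed.

(** If appending [s] shortens [v], then some reduced word for the same element ends in [s], and that
    last letter negates the simple root. *)
Lemma nonneg_or u s : nonneg (act u (sroot R s)) \/ nonneg (- act u (sroot R s)).
Proof.
have [v uv hv] := exists_reduced m u; rewrite (act_coxeq _ uv).
have [h|h] := EM (reduced_word m (rcons v s)).
  by left; apply: reduced_rcons_nonneg.
have [w [vw hw e]] := not_reduced_rcons hv h; right.
have ev : v ~ rcons w s.
  apply: (@coxeq_trans _ _ _ (rcons v s ++ [:: s])).
    rewrite -cats1 -catA -[X in X ~ _]cats0; apply: coxeq_catl.
    exact/coxeq_sym/coxeq_sq.
  by rewrite -[X in _ ~ X]cats1; apply: coxeq_catr.
rewrite (act_coxeq _ ev) act_rcons (reflb (bform_rootrr HC s)) actN opprK.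
apply: reduced_rcons_nonneg; apply: (reduced_eq_size hv ev).
by rewrite size_rcons e.
Qed.

Lemma reduced_last_nonpos u s : reduced_word m (rcons u s) ->
  nonneg (- act (rcons u s) (sroot R s)).
Proof.
move=> h; rewrite act_rcons (reflb (bform_rootrr HC s)) actN opprK.
exact: reduced_rcons_nonneg.
Qed.

(** The last letter of a reduced word for [u] has this property. *)
Lemma not_coxeq_nil_nonpos u : ~ (u ~ [::]) -> exists s, nonneg (- act u (sroot R s)).
Proof.
move=> hu; have [v uv hv] := exists_reduced m u.
case: (lastP v) uv hv => [/hu//|w s uw hw]; exists s.
by rewrite (act_coxeq _ uw); apply: reduced_last_nonpos.
Qed.

Lemma act_faithful u : (forall s, act u (sroot R s) = sroot R s) -> u ~ [::].
Proof.
move=> h; apply: contrapT => /not_coxeq_nil_nonpos[s]; rewrite h => /(_ s).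
by rewrite !ffunE eqxx oppr_ge0 ler10.
Qed.

End Tits.

(** * Perron-Frobenius vectors *)

Section Definiteness.
Variables (R : realType) (S : finType) (B : S -> S -> R).
Hypothesis HC : cartan B.
Local Notation V := {ffun S -> R}.
Local Notation bform := (bform B).
Local Notation sroot := (sroot R).
Implicit Types (v w x y p : V) (s t i j : S) (X Y : pred S) (l : seq S).

Definition pdef X := forall v, supp X v -> v != 0 -> 0 < bform v v.
Definition psdef X := forall v, supp X v -> 0 <= bform v v.

Lemma vec_neq0 v i : v i != 0 -> v != 0.
Proof. by apply: contra => /eqP ->; rewrite ffunE. Qed.

Lemma vec_neq0_ex v : v != 0 -> exists i, v i != 0.
Proof.
apply: contra_neqP => /forallNP h; apply/ffunP => i; rewrite ffunE.
by apply/eqP; have /negP/negPn := h i.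
Qed.

Lemma supp_sub X Y v : {subset X <= Y} -> supp X v -> supp Y v.
Proof. by move=> h hv i hi; apply: hv; apply: contra hi; apply: h. Qed.

Lemma pdef_sub X Y : {subset X <= Y} -> pdef Y -> pdef X.
Proof. by move=> h hY v hv; apply: hY; apply: supp_sub hv. Qed.

Lemma bform_orth X v w : supp X v -> (forall t, t \in X -> bform (sroot t) w = 0) ->
  bform v w = 0.
Proof. by move=> hv h; rewrite (bformEX _ _ hv) big1 // => i hi; rewrite h // mulr0. Qed.

Lemma bform_root_notin X v s : supp X v -> nonneg v -> s \notin X ->
  bform v (sroot s) <= 0.
Proof.
move=> hv nv hs; rewrite (bformEX _ _ hv); apply: sumr_le0 => i hi.
rewrite mulr_ge0_le0 // bform_sroot (cartan_le0 HC) //.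
by apply: contraNneq hs => <-.
Qed.

(** Gram-Schmidt, one root at a time: [e] is the part of the new simple root orthogonal to the
    earlier ones, so adding a multiple of [e] adjusts the new pairing and keeps the old ones. *)
Lemma pdef_solve l : uniq l -> pdef [in l] -> forall b : S -> R,
  exists p, supp [in l] p /\ forall t, t \in l -> bform p (sroot t) = b t.
Proof.
elim: l => [_ _ b|s l IH /= /andP[sl ul] hp b]; first by exists 0; split => //; apply: supp0.
have sub : {subset [in l] <= [in s :: l]} by move=> i hi; rewrite !inE; apply/orP; right.
have hp' := pdef_sub sub hp.
have [p [sp ep]] := IH ul hp' b.
have [q [sq eq]] := IH ul hp' (fun t => - B s t).
set e := sroot s + q.
have se : supp [in s :: l] e.
  by apply: suppD; [apply: supp_sroot; rewrite !inE eqxx | apply: supp_sub sq].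
have oe t : t \in l -> bform e (sroot t) = 0.
  by move=> ht; rewrite bformDl bform_sroot eq // subrr.
have es : e s = 1 by rewrite !ffunE eqxx sq // addr0.
have ee : bform e (sroot s) = bform e e.
  rewrite {3}/e (bformDr HC) (bformC HC e q) (@bform_orth [in l] q e) ?addr0 //.
  by move=> t ht; rewrite (bformC HC) oe.
have e0 : 0 < bform e e by apply: hp => //; apply: (@vec_neq0 _ s); rewrite es oner_neq0.
exists (p + scalev ((b s - bform p (sroot s)) / bform e e) e); split.
  by apply: suppD; [apply: supp_sub sp | apply: suppZ].
move=> t; rewrite inE bformDl bformZl => /orP[/eqP ->|ht].
  by rewrite ee; field; rewrite gt_eqF.
by rewrite ep // oe // mulr0 addr0.
Qed.

(** The inverse of a definite matrix with nonpositive off-diagonal entries is nonnegative. With [n]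
    the negative part of [p], [<p|n> >= 0] by hypothesis, while [<p + n|n> <= 0] because the two
    parts have disjoint supports; hence [<n|n> <= 0]. *)
Lemma pdef_solve_ge0 X p : pdef X -> supp X p ->
  (forall t, t \in X -> 0 <= bform p (sroot t)) -> nonneg p.
Proof.
move=> hp sp hb; pose n : V := [ffun i => Num.max (- p i) 0].
have nn : nonneg n by move=> i; rewrite ffunE le_max lexx orbT.
have sn : supp X n by move=> i hi; rewrite ffunE sp // oppr0 maxxx.
have h1 : 0 <= bform p n.
  rewrite (bformC HC) (bformEX _ _ sn); apply: sumr_ge0 => i hi.
  by rewrite mulr_ge0 // (bformC HC) hb.
have h2 : bform (p + n) n <= 0.
  rewrite /bform; apply: sumr_le0 => i _; apply: sumr_le0 => j _.
  have pn k : (p + n) k = Num.max (p k) 0.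
    by rewrite !ffunE; case: (lerP (- p k) 0); case: (lerP (p k) 0); lra.
  have [<-|ne] := eqVneq i j.
    rewrite pn ffunE; case: (lerP (- p i) 0); case: (lerP (p i) 0); rewrite ?mul0r ?mulr0 ?mul0r //; lra.
  apply: mulr_ge0_le0; last exact: (cartan_le0 HC).
  by apply: mulr_ge0; rewrite // pn le_max lexx orbT.
move: h2; rewrite bformDl => h2.
have n0 : n = 0.
  by apply/eqP/negPn/negP => h; have := hp n sn h; lra.
move=> i; have := congr1 (fun f : V => f i) n0; rewrite !ffunE => h.
by rewrite -oppr_le0 -h le_max lexx.
Qed.

(** When [s] is added to a definite part, the vector [e], which is [a_s] made orthogonal to that
    part, is nonnegative. If [<e|e> <= 0] it is the vector sought; otherwise completing the square
    along [e] extends definiteness. *)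
Lemma pdef_or_nonpos l : uniq l -> pdef [in l] \/
  exists y, [/\ supp [in l] y, nonneg y, y != 0 &
    forall t, t \in l -> bform y (sroot t) <= 0].
Proof.
elim: l => [_|s l IH /= /andP[sl ul]].
  by left=> v hv /eqP[]; apply/ffunP => i; rewrite hv // ffunE.
have sub : {subset [in l] <= [in s :: l]} by move=> i hi; rewrite !inE; apply/orP; right.
case: (IH ul) => [hp|[y [sy ny y0 hy]]]; last first.
  right; exists y; split => //; first exact: supp_sub sy.
  move=> t; rewrite inE => /orP[/eqP ->|]; last exact: hy.
  exact: bform_root_notin sy ny _.
have [q [sq eq]] := pdef_solve ul hp (fun t => - B s t).
have nq : nonneg q.
  apply: (pdef_solve_ge0 hp sq) => t ht; rewrite eq // oppr_ge0 (cartan_le0 HC) //.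
  by apply: contraNneq sl => ->.
set e := sroot s + q.
have se : supp [in s :: l] e.
  by apply: suppD; [apply: supp_sroot; rewrite !inE eqxx | apply: supp_sub sq].
have oe t : t \in l -> bform e (sroot t) = 0.
  by move=> ht; rewrite bformDl bform_sroot eq // subrr.
have es : e s = 1 by rewrite !ffunE eqxx sq // addr0.
have oq x : supp [in l] x -> bform x e = 0.
  by move=> hx; apply: bform_orth hx _ => t ht; rewrite (bformC HC) oe.
have ee : bform e (sroot s) = bform e e.
  by rewrite {3}/e (bformDr HC) (bformC HC e q) oq ?addr0.
have [le|gt] := leP (bform e e) 0.
  right; exists e; split => //.
  - by move=> i; rewrite ffunE addr_ge0 //; apply: nonneg_sroot.
  - by apply: (@vec_neq0 _ s); rewrite es oner_neq0.
  by move=> t; rewrite inE => /orP[/eqP ->|ht]; [rewrite ee | rewrite oe].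
left=> v sv v0; set x := v - scalev (v s) e.
have sx : supp [in l] x.
  move=> i hi; rewrite !ffunE; have [->|ne] := eqVneq i s.
    by rewrite sq // addr0 mulr1 subrr.
  have hi' : i \notin [in s :: l] by rewrite !inE in hi *; rewrite negb_or ne.
  by rewrite (sv i hi') (sq i hi) addr0 mulr0 subrr.
have ev : v = x + scalev (v s) e by rewrite subrK.
clearbody x e; rewrite {1 2}ev !(bformE HC) (bformC HC e x) oq // !mulr0 addr0 add0r.
have [x0|x0] := eqVneq x 0.
  rewrite x0 bform0l add0r mulrA; apply: mulr_gt0 => //.
  rewrite -expr2 exprn_even_gt0 //=; apply: contra v0 => /eqP vs0.
  by rewrite ev x0 vs0 scale0v addr0.
apply: ltr_pwDl; first exact: hp.
by rewrite mulrA mulr_ge0 ?(ltW gt) // -expr2 sqr_ge0.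
Qed.

(** Connectedness as an induction principle along nonorthogonal simple roots, so that no path has to
    be handled later. *)
Definition conn_part X := forall P : S -> Prop, (exists2 s, s \in X & P s) ->
  (forall s t, s \in X -> t \in X -> P s -> s != t -> B s t < 0 -> P t) ->
  forall t, t \in X -> P t.

(* The matrix [2 - B] is entrywise nonnegative with unit diagonal, and commutes with [B];
   iterating it spreads the support of a nonnegative vector over a connected part. *)
Definition smooth v : V := [ffun i => 2 * v i - bform v (sroot i)].

Lemma smoothE v i : smooth v i = v i + \sum_(j | j != i) v j * - B j i.
Proof.
rewrite ffunE bformEl (bigD1 i) //= bform_rootrr // mulr1.
rewrite (eq_bigr (fun j => - (v j * - B j i))); last first.
  by move=> j _; rewrite bform_sroot mulrN opprK.
by rewrite sumrN; ring.
Qed.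

Lemma smooth_ge v i : nonneg v -> v i <= smooth v i.
Proof.
move=> nv; rewrite smoothE lerDl; apply: sumr_ge0 => j ne.
by rewrite mulr_ge0 // oppr_ge0 (cartan_le0 HC).
Qed.

Lemma smooth_nonneg v : nonneg v -> nonneg (smooth v).
Proof. by move=> nv i; apply: le_trans (smooth_ge i nv). Qed.

Lemma smooth_gt v s t : nonneg v -> 0 < v s -> s != t -> B s t < 0 -> 0 < smooth v t.
Proof.
move=> nv hs ne hB; rewrite smoothE (bigD1 s) //=.
have h1 : 0 < v s * - B s t by rewrite mulr_gt0 // oppr_gt0.
have h2 : 0 <= \sum_(j | (j != t) && (j != s)) v j * - B j t.
  apply: sumr_ge0 => j /andP[nej _]; by rewrite mulr_ge0 // oppr_ge0 (cartan_le0 HC).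
have := nv t; lra.
Qed.

Lemma supp_smooth X v : closed_part B X -> supp X v -> supp X (smooth v).
Proof. by move=> hX hv i hi; rewrite ffunE hv // (bform_root_supp hX) // mulr0 subr0. Qed.

Definition covec v : V := [ffun i => bform v (sroot i)].

Lemma covec_smooth v : covec (smooth v) = smooth (covec v).
Proof.
have e : smooth v = scalev 2 v - covec v by apply/ffunP => i; rewrite !ffunE.
by apply/ffunP => i; rewrite e !ffunE bformBl bformZl.
Qed.

Lemma smoothN v : smooth (- v) = - smooth v.
Proof. by apply/ffunP => i; rewrite !ffunE bformNl; ring. Qed.

Lemma iter_smooth_ge v n k i : nonneg v ->
  iter n smooth v i <= iter (n + k) smooth v i.
Proof.
move=> nv; elim: k => [|k IH]; rewrite ?addn0 // addnS /=.
apply: le_trans IH (smooth_ge _ _); elim: (n + k)%N => //= q; exact: smooth_nonneg.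
Qed.

Lemma iter_smooth_nonneg v n : nonneg v -> nonneg (iter n smooth v).
Proof. by move=> nv i; apply: le_trans (iter_smooth_ge 0 n i nv). Qed.

Lemma iter_smooth_pos X v : conn_part X -> nonneg v -> supp X v -> v != 0 ->
  exists n, forall k t, t \in X -> (n <= k)%N -> 0 < iter k smooth v t.
Proof.
move=> hX nv sv v0.
have h1 t : t \in X -> exists n, 0 < iter n smooth v t.
  move: t; apply: hX.
    have [s vs|h] := pickP (fun s => v s != 0); last first.
      by case/eqP: v0; apply/ffunP => i; rewrite ffunE; have /= /negbFE/eqP := h i.
    exists s; last by exists 0%N; rewrite /= lt0r vs nv.
    by apply: contraNT vs => hs; rewrite sv.
  move=> s t _ _ [n hn] ne hB; exists n.+1 => /=.
  by apply: smooth_gt hn ne hB; apply: iter_smooth_nonneg.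
have h2 : exists f : S -> nat, forall t, t \in X -> 0 < iter (f t) smooth v t.
  apply: (@fin_all_exists _ _ (fun t n => t \in X -> 0 < iter n smooth v t)) => t.
  by case: (boolP (t \in X)) => [/h1[n hn]|_]; [exists n | exists 0%N].
case: h2 => f hf; exists (\max_t f t) => k t ht le.
apply: lt_le_trans (hf t ht) _.
have le' : (f t <= k)%N := leq_trans (leq_bigmax t) le.
by rewrite -(subnKC le') iter_smooth_ge.
Qed.

Lemma iter_covec_smooth v n : covec (iter n smooth v) = iter n smooth (covec v).
Proof. by elim: n => //= n <-; rewrite covec_smooth. Qed.

Lemma supp_iter_smooth X v n : closed_part B X -> supp X v -> supp X (iter n smooth v).
Proof. by move=> hX hv; elim: n => //= n; apply: supp_smooth. Qed.

Lemma iter_smoothN v n : iter n smooth (- v) = - iter n smooth v.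
Proof. by elim: n => //= n ->; rewrite smoothN. Qed.

Lemma not_pdef_vec X : closed_part B X -> ~ pdef X ->
  exists y, [/\ supp X y, nonneg y, y != 0 & forall t, bform y (sroot t) <= 0].
Proof.
move=> hX hn; case: (pdef_or_nonpos (enum_uniq X)) => [h|[y [sy ny y0 hy]]].
  by case: hn => v hv; apply: h; apply: supp_sub hv => i; rewrite -mem_enum.
have sy' : supp X y by apply: supp_sub sy => i; rewrite -[i \in X]mem_enum.
exists y; split => // t; case: (boolP (t \in X)) => ht; first by apply: hy; rewrite mem_enum.
exact: bform_root_notin sy' ny ht.
Qed.

(** Substituting [v = y u] coordinatewise, the null vector [y] cancels the square terms and leaves
    [-2 <v|v> = sum y_i y_j (u_i - u_j)^2 B_ij], whose off-diagonal terms are nonpositive. *)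
Lemma pos_null_psdef X y : supp X y -> (forall s, s \in X -> 0 < y s) ->
  (forall t, t \in X -> bform y (sroot t) = 0) -> psdef X.
Proof.
move=> sy py hy v sv; pose u i := v i / y i.
have vu i : v i = y i * u i.
  rewrite /u; case: (boolP (i \in X)) => hi; first by field; rewrite gt_eqF ?py.
  by rewrite sv // sy // mul0r.
have e1 : \sum_i \sum_j y i * y j * u i ^+ 2 * B i j = 0.
  apply: big1 => i _; rewrite (eq_bigr (fun j => (y i * u i ^+ 2) * (y j * B j i))).
    rewrite -mulr_sumr; have [hi|hi] := boolP (i \in X); last by rewrite sy // !mul0r.
    have := hy i hi; rewrite bformEl => h.
    by rewrite (eq_bigr (fun s => y s * bform (sroot s) (sroot i))) ?h ?mulr0 //
      => j _; rewrite bform_sroot.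
  by move=> j _; rewrite (cartan_sym HC i j); ring.
have e2 : \sum_i \sum_j y i * y j * u j ^+ 2 * B i j = 0.
  rewrite exchange_big -[RHS]e1; apply: eq_bigr => i _; apply: eq_bigr => j _.
  by rewrite (cartan_sym HC i j); ring.
have e3 : \sum_i \sum_j y i * y j * (u i - u j) ^+ 2 * B i j = - 2 * bform v v.
  transitivity (\sum_i \sum_j y i * y j * u i ^+ 2 * B i j
    + \sum_i \sum_j y i * y j * u j ^+ 2 * B i j - 2 * bform v v).
    rewrite /bform mulr_sumr -big_split -sumrB; apply: eq_bigr => i _ /=.
    rewrite mulr_sumr -big_split -sumrB; apply: eq_bigr => j _ /=.
    by rewrite !vu; ring.
  by rewrite e1 e2; ring.
have ny i : 0 <= y i.
  by case: (boolP (i \in X)) => hi; [rewrite ltW ?py | rewrite sy].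
have : \sum_i \sum_j y i * y j * (u i - u j) ^+ 2 * B i j <= 0.
  apply: sumr_le0 => i _; apply: sumr_le0 => j _; have [->|ne] := eqVneq i j.
    by rewrite subrr expr0n mulr0 mul0r.
  apply: mulr_ge0_le0; last exact: (cartan_le0 HC).
  by rewrite mulr_ge0 ?sqr_ge0 // mulr_ge0.
rewrite e3; lra.
Qed.

(** Smoothing commutes with the form, so it spreads the support of [y] over [X] while its pairings
    stay nonpositive. *)
Lemma nonspherical_vec X : closed_part B X -> conn_part X -> ~ pdef X ->
  exists z, [/\ supp X z, forall s, s \in X -> 0 < z s &
    forall t, bform z (sroot t) <= 0].
Proof.
move=> hX cX hn; have [y [sy ny y0 hy]] := not_pdef_vec hX hn.
have [n hpos] := iter_smooth_pos cX ny sy y0.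
exists (iter n smooth y); split; first exact: supp_iter_smooth.
  by move=> s hs; apply: hpos.
move=> t; have := congr1 (fun f : V => f t) (iter_covec_smooth y n); rewrite ffunE => ->.
rewrite -[covec y]opprK iter_smoothN ffunE oppr_le0; apply: iter_smooth_nonneg => i.
by rewrite !ffunE oppr_ge0.
Qed.

(** The pairings of [y] do not all vanish, since otherwise a smoothed [y] would be a positive null
    vector and the form semidefinite. Smoothing therefore makes both [y] and minus its pairings
    strictly positive on [X]; [n + n'] steps serve both. *)
Lemma generic_vec X : closed_part B X -> conn_part X -> ~ psdef X ->
  exists z, [/\ supp X z, forall s, s \in X -> 0 < z s &
    forall t, t \in X -> bform z (sroot t) < 0].
Proof.
move=> hX cX hn.
have hn' : ~ pdef X.
  move=> h; apply: hn => v sv; have [->|v0] := eqVneq v 0; first by rewrite bform0l.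
  exact/ltW/h.
have [y [sy ny y0 hy]] := not_pdef_vec hX hn'.
have [n hpos] := iter_smooth_pos cX ny sy y0.
have nc : nonneg (- covec y) by move=> i; rewrite !ffunE oppr_ge0.
have sc : supp X (- covec y).
  by move=> i hi; rewrite !ffunE (bform_root_supp hX) // oppr0.
have c0 : - covec y != 0.
  rewrite oppr_eq0; apply/eqP => c0; apply: hn.
  have hc k t : bform (iter k smooth y) (sroot t) = 0.
    have := congr1 (fun f : V => f t) (iter_covec_smooth y k); rewrite ffunE => ->.
    have s0 : smooth 0 = 0 by apply/ffunP => i; rewrite !ffunE bform0l mulr0 subr0.
    by rewrite c0; elim: k => [|k IH]; rewrite ?iterSr ?s0 ?ffunE.
  apply: (@pos_null_psdef _ (iter n smooth y)) => //; first exact: supp_iter_smooth.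
  by move=> s hs; apply: hpos.
have [n' hneg] := iter_smooth_pos cX nc sc c0.
exists (iter (n + n') smooth y); split; first exact: supp_iter_smooth.
  by move=> s hs; apply: hpos; rewrite // leq_addr.
move=> t ht; have := congr1 (fun f : V => f t) (iter_covec_smooth y (n + n')).
rewrite ffunE => ->; rewrite -[covec y]opprK iter_smoothN ffunE oppr_lt0.
by apply: hneg; rewrite // leq_addl.
Qed.

End Definiteness.

(** * Finite normal subgroups *)

Section FiniteNormal.
Variables (R : realType) (S : finType) (m : S -> S -> nat) (B : S -> S -> R).
Hypothesis HB : coxeter_form m B.
Let HC : cartan B := HB.
Local Notation V := {ffun S -> R}.
Local Notation bform := (bform B).
Local Notation sroot := (sroot R).
Local Notation act := (act B).
Implicit Types (v x y z : V) (s t i j : S) (X Y : pred S) (u w h : seq S).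

Section Dominant.
Variable z : V.
Hypothesis hz : forall t, bform z (sroot t) <= 0.

(** Along a reduced word, each further letter [s] adds [-2 <z|a_s>] times the root [w a_s], which is
    positive. *)
Lemma act_dominant_ge w : nonneg (act w z - z).
Proof.
have [w' ww' red] := exists_reduced m w; rewrite (act_coxeq HB _ ww') {w ww'}.
elim/last_ind: w' red => [_|w s IH red]; first by move=> i; rewrite !ffunE subrr.
have -> : act (rcons w s) z - z = (act w z - z) + scalev (- 2 * bform z (sroot s)) (act w (sroot s)).
  by rewrite act_rcons /refl actB actZ; apply/ffunP => i; rewrite !ffunE; ring.
apply: nonnegD; first by apply: IH; apply: (@reduced_catl _ _ _ [:: s]); rewrite cats1.
apply: nonnegZ; last exact: (reduced_rcons_nonneg HB).
by have := hz s; lra.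
Qed.

End Dominant.

Definition coord_sum v : R := \sum_i v i.

Lemma coord_sum_ge0 v : nonneg v -> 0 <= coord_sum v.
Proof. by move=> nv; apply: sumr_ge0. Qed.

Lemma coord_sumD v x : coord_sum (v + x) = coord_sum v + coord_sum x.
Proof. by rewrite /coord_sum -big_split; apply: eq_bigr => i _; rewrite ffunE. Qed.

Lemma coord_sumZ a v : coord_sum (scalev a v) = a * coord_sum v.
Proof. by rewrite /coord_sum mulr_sumr; apply: eq_bigr => i _; rewrite ffunE. Qed.

(** Functionals are given by their values on the simple roots and not through [bform], which may be
    degenerate. *)
Definition dot (f v : V) : R := \sum_i f i * v i.

Lemma dotDr f x y : dot f (x + y) = dot f x + dot f y.
Proof. by rewrite /dot -big_split; apply: eq_bigr => i _; rewrite ffunE mulrDr. Qed.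
Lemma dotZr f a x : dot f (scalev a x) = a * dot f x.
Proof. by rewrite /dot mulr_sumr; apply: eq_bigr => i _; rewrite ffunE mulrCA. Qed.
Lemma dotBr f x y : dot f (x - y) = dot f x - dot f y.
Proof. by rewrite -scaleN1v dotDr dotZr mulN1r. Qed.
Lemma dot_sroot f s : dot f (sroot s) = f s.
Proof.
rewrite /dot (bigD1 s) //= big1 ?addr0 ?ffunE ?eqxx ?mulr1 // => j ne.
by rewrite ffunE (negbTE ne) mulr0.
Qed.
Lemma dot_suml (I : Type) (r : seq I) (F : I -> V) v :
  dot (\sum_(k <- r) F k) v = \sum_(k <- r) dot (F k) v.
Proof.
rewrite /dot exchange_big; apply: eq_bigr => i _.
by rewrite sum_ffunE mulr_suml.
Qed.

Variables (H : seq S -> Prop) (X : pred S) (z : V).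
Hypotheses (hH : normal_subgroup m H) (hX : closed_part B X) (cX : conn_part B X).
Hypotheses (sz : supp X z) (pz : forall s, s \in X -> 0 < z s).
Hypothesis hz : forall t, bform z (sroot t) <= 0.

Lemma normal_nil : H [::]. Proof. by case: hH. Qed.
Lemma normal_cat u w : H u -> H w -> H (u ++ w). Proof. by case: hH => _ _ h _ _; apply: h. Qed.
Lemma normal_rev u : H u -> H (rev u). Proof. by case: hH => _ _ _ h _; apply: h. Qed.
Lemma normal_conj u g : H u -> H (g ++ u ++ rev g).
Proof. by case: hH => _ _ _ _ h /(h _ (rev g)); rewrite /winv revK. Qed.
(** Cut off outside [X], so that it depends on [h] only through the action on the component. *)
Definition pullback h : V := [ffun i => if i \in X then coord_sum (act h (sroot i)) else 0].
Definition transl h (f : V) : V := [ffun i => if i \in X then dot f (act h (sroot i)) else 0].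

Lemma dot_lin (L : V -> R) (f : V) v : (forall x y, L (x + y) = L x + L y) ->
  (forall a x, L (scalev a x) = a * L x) -> supp X v ->
  (forall i, i \in X -> f i = L (sroot i)) -> dot f v = L v.
Proof.
move=> LD LZ sv hf; rewrite [in RHS](vec_decomp v).
have L0 : L 0 = 0 by rewrite -(scale0v 0) LZ mul0r.
rewrite (big_morph L LD L0); apply: eq_bigr => i _; rewrite LZ mulrC.
by have [hi|hi] := boolP (i \in X); [rewrite hf | rewrite sv // !mul0r].
Qed.

Lemma dot_pullback h v : supp X v -> dot (pullback h) v = coord_sum (act h v).
Proof.
move=> sv; apply: (dot_lin (L := fun v => coord_sum (act h v))) => //.
- by move=> x y; rewrite actD coord_sumD.
- by move=> a x; rewrite actZ coord_sumZ.
- by move=> i hi; rewrite ffunE hi.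
Qed.

Lemma dot_transl h f v : supp X v -> dot (transl h f) v = dot f (act h v).
Proof.
move=> sv; apply: (dot_lin (L := fun v => dot f (act h v))) => //.
- by move=> x y; rewrite actD dotDr.
- by move=> a x; rewrite actZ dotZr.
- by move=> i hi; rewrite ffunE hi.
Qed.

Lemma transl_pullback h h' : transl h (pullback h') = pullback (h' ++ h).
Proof.
apply/ffunP => i; rewrite !ffunE; case: ifP => // hi.
by rewrite dot_pullback ?act_cat //; apply: supp_act => //; apply: supp_sroot.
Qed.

(** The sum runs over the distinct pullbacks, since [H] itself need not be finite here. Translation
    by an element of [H] is an injective map of this finite set into itself, hence permutes it. *)
Lemma finite_image_fixed_functional (l : seq V) s0 : s0 \in X ->
  (forall h, H h -> pullback h \in l) ->
  exists f : V, (exists2 s, s \in X & f s != 0) /\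
    forall h v, H h -> supp X v -> dot f (act h v) = dot f v.
Proof.
move=> hs0 hl; pose o := undup [seq f <- l | `[< exists2 h, H h & f = pullback h >]].
have uo : uniq o by apply: undup_uniq.
have oP f : reflect (exists2 h, H h & f = pullback h) (f \in o).
  rewrite mem_undup mem_filter; apply: (iffP andP) => [[/asboolP //]|h].
  by split; [apply/asboolP | case: h => h Hh ->; apply: hl].
exists (\sum_(f <- o) f); split; last first.
  move=> h v Hh sv; rewrite !dot_suml.
  have uto : uniq (map (transl h) o).
    rewrite map_inj_in_uniq // => _ _ /oP[h1 H1 ->] /oP[h2 H2 ->] e.
    apply/ffunP => i; rewrite !ffunE; case: ifP => // hi.
    have ss := supp_sroot R hi.
    rewrite -!dot_pullback // -(actKV HC h (sroot i)) -!dot_transl ?e //;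
      exact: supp_act.
  have sub : {subset map (transl h) o <= o}.
    move=> _ /mapP[_ /oP[h1 H1 ->] ->]; apply/oP; exists (h1 ++ h).
      exact: normal_cat.
    exact: transl_pullback.
  have pe : perm_eq (map (transl h) o) o.
    apply: uniq_perm => //.
    by have [] := uniq_min_size uto sub; rewrite ?size_map.
  rewrite -[RHS](perm_big _ pe) /= big_map; apply: eq_bigr => f _.
  by rewrite dot_transl.
apply: contrapT => no.
have h0 : dot (\sum_(f <- o) f) z = 0.
  apply: big1 => i _; have [hi|hi] := boolP (i \in X); last by rewrite sz // mulr0.
  have [->|ne] := eqVneq ((\sum_(f <- o) f : V) i) 0; first by rewrite mul0r.
  by case: no; exists i.
have tz : 0 < coord_sum z.
  rewrite /coord_sum (bigD1 s0) //=; apply: ltr_pwDl; first exact: pz.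
  apply: sumr_ge0 => i _; have [hi|hi] := boolP (i \in X); first exact/ltW/pz.
  by rewrite sz.
have o0 : pullback [::] \in o by apply/oP; exists [::] => //; exact: normal_nil.
have ho f : f \in o -> 0 < dot f z.
  move=> /oP[h Hh ->]; rewrite dot_pullback //; apply: lt_le_trans tz _.
  have -> : act h z = z + (act h z - z) by rewrite addrC subrK.
  by rewrite coord_sumD lerDl; apply: coord_sum_ge0; apply: act_dominant_ge.
move: h0; rewrite dot_suml (big_rem _ o0) /= => /eqP; rewrite gt_eqF //.
apply: ltr_pwDl; first exact: ho.
by rewrite big_seq; apply: sumr_ge0 => f /mem_rem/ho/ltW.
Qed.

(** Only the image of [H] on the component is assumed finite: in the generic case the lemma serves
    for a group that is merely bounded there. *)
Lemma finite_image_trivial (l : seq (seq S)) :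
  (forall h, H h -> exists2 w, w \in l & forall s, s \in X -> act h (sroot s) = act w (sroot s)) ->
  forall h s, H h -> s \in X -> act h (sroot s) = sroot s.
Proof.
move=> hl h0 s0 H0 hs0.
have [f [ex hf]] : exists f : V, (exists2 s, s \in X & f s != 0) /\
    forall h v, H h -> supp X v -> dot f (act h v) = dot f v.
  apply: (@finite_image_fixed_functional (map pullback l) s0) => // h /hl[w wl e].
  apply/mapP; exists w => //; apply/ffunP => i; rewrite !ffunE.
  by case: ifP => // hi; rewrite e.
pose P s := forall h v, H h -> supp X v -> bform (act h v) (sroot s) = bform v (sroot s).
have cj s h v : act [:: s] (act h v) = act ([:: s] ++ h ++ [:: s]) (act [:: s] v).
  by rewrite !act_cat -[in RHS](act_cat B [:: s]) /= reflK // bform_rootrr.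
(* By normality [f] is invariant under [h] and under [s h s]. Comparing the two leaves
   [<h v|a_s> f(a_s) = <v|a_s> f(a_s)]. Invariance of [<.|a_s>] passes to a neighbour [t] by the
   same comparison, with [B s t] as the nonzero factor. *)
have hP : forall s, s \in X -> P s.
  apply: cX.
    case: ex => s hs fs; exists s => // h v Hh sv.
    have sv' : supp X (act h v) by apply: supp_act.
    have : dot f (act [:: s] (act h v)) = dot f (act [:: s] v).
      by rewrite cj hf //; [exact: (normal_conj [:: s]) | apply: supp_act].
    rewrite /= /refl !dotBr !dotZr dot_sroot hf // => e.
    by apply: (mulIf fs); lra.
  move=> s t hs ht Ps ne hB h v Hh sv.
  have sv' : supp X (act [:: t] v) by apply: supp_act.
  have := Ps _ _ (normal_conj [:: t] Hh) sv'; rewrite -cj /= !bform_refll bform_sroot Ps //.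
  rewrite (cartan_sym HC) => e.
  have hB' : B s t != 0 by rewrite lt_eqF.
  by apply: (mulIf hB'); lra.
(* [rho] lies in the radical, so the whole group fixes it and the [k]-th power of [h0] moves the
   simple root by [k rho]. With finitely many images this forces [rho = 0]. *)
pose rho := act h0 (sroot s0) - sroot s0.
have srho : supp X rho by apply: suppB; [apply: supp_act => //|]; apply: supp_sroot.
have rad t : bform rho (sroot t) = 0.
  have [ht|ht] := boolP (t \in X); last exact: (bform_root_supp hX).
  by rewrite bformBl hP ?subrr //; apply: supp_sroot.
have fixr u : act u rho = rho by elim: u => //= a u ->; rewrite refl_fix.
pose pw k := flatten (nseq k h0).
have Hpw k : H (pw k).
  by elim: k => [|k IH]; [exact: normal_nil | apply: normal_cat].
have epw k : act (pw k) (sroot s0) = sroot s0 + scalev k%:R rho.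
  elim: k => [|k IH]; first by rewrite scale0v addr0.
  rewrite [pw _]/= act_cat IH actD actZ fixr -natr1.
  by apply/ffunP => i; rewrite !ffunE; ring.
suff r0 : rho = 0 by apply/eqP; rewrite -subr_eq0 -/rho r0.
apply/ffunP => i; rewrite [RHS]ffunE; apply/eqP; apply: contraT => ri.
pose K := \sum_(w <- l) `|act w (sroot s0) i|.
have hK k : `|sroot s0 i + k%:R * rho i| <= K.
  have [w wl e] := hl _ (Hpw k).
  have := e s0 hs0; rewrite epw => /(congr1 (fun f : V => f i)).
  rewrite [in LHS]ffunE [X in _ + X]ffunE => ->.
  rewrite /K (big_rem _ wl) /= lerDl; exact: sumr_ge0.
have := hK (Num.bound ((K + `|sroot s0 i|) / `|rho i|)).
set n := Num.bound _.
have rp : 0 < `|rho i| by rewrite normr_gt0.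
have hn : K + `|sroot s0 i| < n%:R * `|rho i|.
  rewrite -ltr_pdivrMr //; apply: archi_boundP; apply: divr_ge0 => //.
  by apply: addr_ge0 => //; apply: sumr_ge0.
have := lerB_normD (n%:R * rho i) (sroot s0 i).
rewrite [n%:R * rho i + _]addrC normrM normr_nat; lra.
Qed.

End FiniteNormal.

(** * Free subgroups in generic components *)

Section Dihedral.
Variables (R : realType) (S : finType) (B : S -> S -> R).
Hypothesis HC : cartan B.
Local Notation V := {ffun S -> R}.
Local Notation bform := (bform B).
Local Notation refl := (refl B).
Implicit Types (v x y b g : V).

(** Half of the amount by which [r_b r_g] lowers [<v|v>] in [<r_b r_g v|v>]. For a hyperbolic pair
    it is the product of the pairings of [v] with the two axes. *)
Definition qdih b g v : R :=
  bform v b ^+ 2 - 2 * bform b g * bform v b * bform v g + bform v g ^+ 2.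

Lemma bform_refl2 b g v : bform b b = 1 -> bform g g = 1 ->
  bform (refl b (refl g v)) v = bform v v - 2 * qdih b g v.
Proof.
move=> e1 e2; rewrite /qdih /refl !(bformE HC) (bformC HC b v) (bformC HC g v).
by rewrite (bformC HC g b); ring.
Qed.

Lemma hyperbolic_param (c : R) : 1 < c -> exists2 t : R, 1 < t & c = (t + t^-1) / 2.
Proof.
move=> c1; pose r := Num.sqrt (c ^+ 2 - 1).
have h : 0 <= c ^+ 2 - 1 by rewrite subr_ge0 exprn_ege1 // ltW.
have r0 : 0 <= r by apply: sqrtr_ge0.
have r2 : r ^+ 2 = c ^+ 2 - 1 by rewrite sqr_sqrtr.
have t0 : c + r != 0 by rewrite gt_eqF //; lra.
exists (c + r); first lra.
have -> : (c + r)^-1 = c - r.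
  by apply: (mulfI t0); rewrite divff // [RHS]mulrC -subr_sqr r2; ring.
by field.
Qed.

Section Pair.
Variables (b g : V) (t : R).
Hypotheses (hb : bform b b = 1) (hg : bform g g = 1) (t1 : 1 < t).
Hypothesis hbg : bform b g = - ((t + t^-1) / 2).
Let t0 : t != 0. Proof. by rewrite gt_eqF // (lt_trans ltr01). Qed.
Let d := (t - t^-1) / 2.
(** The isotropic eigenvectors of [r_b r_g]: [axis] has eigenvalue [t^2] and [axis'] has eigenvalue
    [t^-2]. *)
Definition axis : V := g + scalev t b.
Definition axis' : V := g + scalev t^-1 b.

Lemma inv_lt1 : 0 < t^-1 < 1.
Proof. by rewrite invr_gt0 invf_lt1 ?(lt_trans ltr01) //. Qed.

Let d0 : t * t - 1 != 0.
Proof. by rewrite gt_eqF // subr_gt0 -[1]mulr1; apply: ltr_pM => //; lra. Qed.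

Lemma qdih_axis v : qdih b g v = bform v axis * bform v axis'.
Proof. by rewrite /qdih /axis /axis' !(bformDr HC, bformZr HC) hbg; field. Qed.

(** Coefficients of [v] along the two axes, modulo their common orthogonal; the denominator comes
    from [<axis|axis'> = - 2 d^2]. *)
Definition dihc v := - (bform v axis') / (2 * d ^+ 2).
Definition dihc' v := - (bform v axis) / (2 * d ^+ 2).

Lemma dihedral_step v : refl b (refl g v) =
  v + scalev (dihc v * (t ^+ 2 - 1)) axis + scalev (dihc' v * (t ^- 2 - 1)) axis'.
Proof.
apply/ffunP => i; rewrite /dihc /dihc' /d /refl /axis /axis' !ffunE !(bformE HC).
rewrite (bformC HC g b) hbg; by field; rewrite t0 /=.
Qed.

Lemma dihedral_axis : refl b (refl g axis) = scalev (t ^+ 2) axis.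
Proof.
apply/ffunP => i; rewrite /refl /axis !ffunE !(bformE HC) (bformC HC g b) hb hg hbg.
by field.
Qed.

Lemma dihedral_axis' : refl b (refl g axis') = scalev (t ^- 2) axis'.
Proof.
apply/ffunP => i; rewrite /refl /axis' !ffunE !(bformE HC) (bformC HC g b) hb hg hbg.
by field.
Qed.

Lemma dihedral_iter n v : iter n (fun v => refl b (refl g v)) v =
  v + scalev (dihc v * ((t ^+ 2) ^+ n - 1)) axis
    + scalev (dihc' v * ((t ^+ 2) ^- n - 1)) axis'.
Proof.
elim: n => [|n IH].
  by rewrite !expr0 invr1 !subrr !mulr0 !scale0v !addr0.
have lin (p q : R) (e f : V) : refl b (refl g (v + scalev p e + scalev q f)) =
    refl b (refl g v) + scalev p (refl b (refl g e)) + scalev q (refl b (refl g f)).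
  by rewrite 2!(reflD B g) 2!(reflZ B g) 2!(reflD B b) 2!(reflZ B b).
rewrite iterS IH lin dihedral_axis dihedral_axis' dihedral_step.
rewrite !(exprS _ n); apply/ffunP => i; rewrite !ffunE; field.
by rewrite t0 !expf_neq0.
Qed.

Lemma bform_dihedral_iter n v y : bform (iter n (fun v => refl b (refl g v)) v) y =
  bform v y + dihc v * bform axis y * ((t ^+ 2) ^+ n - 1)
    + dihc' v * bform axis' y * ((t ^+ 2) ^- n - 1).
Proof. by rewrite dihedral_iter 2!bformDl 2!bformZl; ring. Qed.

Lemma dihedral_iter_b n y : bform (iter n (fun v => refl b (refl g v)) b) y =
  ((t ^+ 2) ^+ n * bform axis y - (t ^+ 2) ^- n * bform axis' y) / (t - t^-1).
Proof.
rewrite bform_dihedral_iter /dihc /dihc' /d /axis /axis' !(bformDr HC) !(bformZr HC).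
rewrite !bformDl !bformZl hb hbg; field.
by rewrite t0 d0 expf_neq0 ?expf_neq0.
Qed.

Lemma dihedral_iter_g n y : bform (iter n (fun v => refl b (refl g v)) y) g =
  (t * (t ^+ 2) ^+ n * bform axis' y - (t ^+ 2) ^- n * t^-1 * bform axis y) / (t - t^-1).
Proof.
rewrite bform_dihedral_iter /dihc /dihc' /d /axis /axis' !(bformDr HC) !(bformZr HC).
rewrite !bformDl !bformZl hg hbg (bformC HC g y) (bformC HC b y); field.
by rewrite t0 d0 expf_neq0 ?expf_neq0.
Qed.

(** The pairing is [-(x + x^-1) / 2] with [x = t^(2n+1)]. *)
Lemma dihedral_iter_bg n : bform (iter n (fun v => refl b (refl g v)) b) g <= -1.
Proof.
have x0 : 0 < (t ^+ 2) ^+ n * t by rewrite mulr_gt0 ?exprn_gt0 // (lt_trans ltr01).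
have -> : bform (iter n (fun v => refl b (refl g v)) b) g =
    - 1 - ((t ^+ 2) ^+ n * t - 1) ^+ 2 / (2 * ((t ^+ 2) ^+ n * t)).
  rewrite dihedral_iter_g /axis /axis' !bformDl !bformZl hb (bformC HC g b) hbg; field.
  by rewrite t0 d0 expf_neq0 ?expf_neq0.
by rewrite gerBl divr_ge0 ?sqr_ge0 // mulr_ge0 // ltW.
Qed.

Lemma pow_unbounded (K : R) : exists n, K < (t ^+ 2) ^+ n.
Proof.
have h : 1 < t ^+ 2 by rewrite exprn_egt1.
move: (t ^+ 2) h => T h.
have bern n : 1 + n%:R * (T - 1) <= T ^+ n.
  elim: n => [|n IH]; first by rewrite mul0r addr0 expr0.
  rewrite exprS -natr1; have := ler_wpM2l (ltW (lt_trans ltr01 h)) IH.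
  have : 0 <= n%:R * ((T - 1) * (T - 1)) by rewrite mulr_ge0 // mulr_ge0 // subr_ge0 ltW.
  move: (n%:R : R) (T ^+ n) => k p; nra.
have p : 0 < T - 1 by rewrite subr_gt0.
exists (Num.bound (`|K| / (T - 1))); apply: lt_le_trans (bern _).
have : `|K| < (Num.bound (`|K| / (T - 1)))%:R * (T - 1).
  by rewrite -ltr_pdivrMr //; apply: archi_boundP; rewrite divr_ge0 // ltW.
have := ler_norm K; lra.
Qed.

(** For large [n] the product has the sign of its dominant coefficient [a1 c1]; [M] bounds the
    contribution of all other coefficients. *)
Lemma leading_coef_ge0 (a0 a1 a2 c0 c1 c2 : R) :
  (forall n, 0 <= (a0 + a1 * (t ^+ 2) ^+ n + a2 * (t ^+ 2) ^- n)
    * (c0 + c1 * (t ^+ 2) ^+ n + c2 * (t ^+ 2) ^- n)) -> 0 <= a1 * c1.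
Proof.
move=> h; rewrite leNgt; apply/negP => lt.
pose M := `|a0 * c1 + a1 * c0| + `|a0 * c0 + a1 * c2 + a2 * c1| + `|a0 * c2 + a2 * c0| + `|a2 * c2|.
have [n hn] := pow_unbounded (1 + M / - (a1 * c1)).
have := h n; set x := (t ^+ 2) ^+ n in hn *.
have M0 : 0 <= M by rewrite !addr_ge0.
have p : 0 < - (a1 * c1) by rewrite oppr_gt0.
have x1 : 1 < x by apply: le_lt_trans hn; rewrite lerDl divr_ge0 // ltW.
have x0 : 0 < x := lt_trans ltr01 x1.
have y1 : 0 < x^-1 <= 1 by rewrite invr_gt0 x0 invf_le1 // ltW.
have hM : M < - (a1 * c1) * x.
  rewrite mulrC -ltr_pdivrMr //; lra.
have bnd (u k : R) : 0 <= k <= 1 -> u * k <= `|u|.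
  move=> /andP[k0 k1]; apply: le_trans (ler_norm _) _.
  by rewrite normrM (ger0_norm k0) ler_piMr.
have e : (a0 + a1 * x + a2 * x^-1) * (c0 + c1 * x + c2 * x^-1) =
  x * (a1 * c1 * x + (a0 * c1 + a1 * c0) + (a0 * c0 + a1 * c2 + a2 * c1) * x^-1
   + (a0 * c2 + a2 * c0) * (x^-1 * x^-1) + a2 * c2 * (x^-1 * x^-1 * x^-1)).
  by field; rewrite gt_eqF.
rewrite e pmulr_rge0 // => hh.
have [yp yl] := andP y1.
have y2 : 0 <= x^-1 * x^-1 <= 1.
  by rewrite mulr_ge0 ?(ltW yp) //= mulr_ile1 ?(ltW yp).
have y3 : 0 <= x^-1 * x^-1 * x^-1 <= 1.
  have [u1 u2] := andP y2.
  by rewrite mulr_ge0 ?(ltW yp) //= mulr_ile1 ?(ltW yp).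
have y1' : 0 <= x^-1 <= 1 by rewrite yl ltW.
have := bnd (a0 * c0 + a1 * c2 + a2 * c1) _ y1'.
have := bnd (a0 * c2 + a2 * c0) _ y2; have := bnd (a2 * c2) _ y3.
have := ler_norm (a0 * c1 + a1 * c0).
rewrite /M in hM; lra.
Qed.

(* The orbit of [v] is asymptotic to [axis], so the sign of [<.|e1><.|e2>] on the orbit
   is inherited by [axis]. *)
Lemma axis_sign (eps : R) (P : V -> Prop) (e1 e2 v : V) : P v ->
  (forall x, P x -> P (refl b (refl g x))) ->
  (forall x, P x -> 0 <= eps * (bform x e1 * bform x e2)) ->
  bform v axis' != 0 -> 0 <= eps * (bform axis e1 * bform axis e2).
Proof.
move=> Pv Pst Pge va.
have Pit n : P (iter n (fun v => refl b (refl g v)) v).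
  by elim: n => //= n; apply: Pst.
have dc0 : 0 < dihc v ^+ 2.
  rewrite exprn_even_gt0 //= /dihc mulf_neq0 ?oppr_eq0 // invr_eq0 mulf_neq0 ?pnatr_eq0 //.
  rewrite expf_neq0 // /d mulf_neq0 ?invr_eq0 ?pnatr_eq0 // subr_eq0.
  by have /andP[_ h] := inv_lt1; rewrite gt_eqF // (lt_trans h).
suff : 0 <= (eps * (dihc v * bform axis e1)) * (dihc v * bform axis e2).
  have -> : (eps * (dihc v * bform axis e1)) * (dihc v * bform axis e2) =
    dihc v ^+ 2 * (eps * (bform axis e1 * bform axis e2)) by ring.
  by rewrite pmulr_rge0.
pose A w := bform v w - dihc v * bform axis w - dihc' v * bform axis' w.
apply: (@leading_coef_ge0 (eps * A e1) _ (eps * (dihc' v * bform axis' e1))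
  (A e2) _ (dihc' v * bform axis' e2)) => n.
have := Pge _ (Pit n); rewrite !bform_dihedral_iter; congr (0 <= _).
by rewrite /A; ring.
Qed.

End Pair.
End Dihedral.

(** * Ping-pong with three reflections *)

Section PingPong.
Variables (R : realType) (S : finType) (m : S -> S -> nat) (B : S -> S -> R).
Hypothesis HB : coxeter_form m B.
Let HC : cartan B := HB.
Local Notation V := {ffun S -> R}.
Local Notation bform := (bform B).
Local Notation refl := (refl B).
Local Notation act := (act B).
Variables (b1 b2 b3 : V) (u c : seq S).
Hypotheses (h1 : bform b1 b1 = 1) (h2 : bform b2 b2 = 1) (h3 : bform b3 b3 = 1).
Hypotheses (h12 : bform b1 b2 <= -1) (h13 : bform b1 b3 <= -1) (h23 : bform b2 b3 <= -1).
Hypothesis act_u : forall v, act u v = refl b1 (refl b2 v).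
Hypothesis act_c : forall v, act c v = refl b3 v.
Implicit Types (v : V) (l : bool * bool) (w : seq (bool * bool)).

(** Ping-pong sets for the three reflections: the reflection in [x] maps the wedges of the other two
    roots into the wedge of [x], as soon as all products are at most [-1]. *)
Definition wedge (x y z v : V) : Prop :=
  [/\ 0 < bform v x, bform v y <= - bform v x & bform v z <= - bform v x].

Lemma wedgeC x y z v : wedge x y z v -> wedge x z y v.
Proof. by case. Qed.

Lemma wedge_refl x y z v : bform x x = 1 -> bform x y <= -1 -> bform x z <= -1 ->
  wedge y x z v \/ wedge y z x v -> wedge x y z (refl x v).
Proof.
move=> xx xy xz h; have {h} [p q r] : wedge y x z v by case: h => // /wedgeC.
have n1 : bform v x <= 0 by lra.
have k y' : bform x y' <= -1 -> 0 <= bform v x * (bform x y' + 1).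
  by move=> h; rewrite mulr_le0 //; lra.
have := k _ xy; have := k _ xz; split; rewrite !bform_refll ?xx; lra.
Qed.

(** The zone of a letter is the wedge of the first reflection in it; for the conjugated generator it
    is the image of that wedge under [r3], which lies inside the wedge of [b3]. *)
Definition zone l v : Prop :=
  match l with
  | (false, false) => wedge b1 b2 b3 v
  | (false, true) => wedge b2 b1 b3 v
  | (true, false) => wedge b1 b2 b3 (refl b3 v)
  | (true, true) => wedge b2 b1 b3 (refl b3 v)
  end.

Definition letter l : seq S :=
  let g := if l.1 then c ++ u ++ rev c else u in if l.2 then winv g else g.

Lemma act_rev_u v : act (rev u) v = refl b2 (refl b1 v).
Proof.
rewrite -{1}(reflK v h1) -{1}(reflK (refl b1 v) h2) -act_u.
by rewrite actK.
Qed.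

Lemma act_rev_c v : act (rev c) v = refl b3 v.
Proof. by rewrite -{1}(reflK v h3) -act_c actK. Qed.

Lemma act_letter l v : act (letter l) v =
  match l with
  | (false, false) => refl b1 (refl b2 v)
  | (false, true) => refl b2 (refl b1 v)
  | (true, false) => refl b3 (refl b1 (refl b2 (refl b3 v)))
  | (true, true) => refl b3 (refl b2 (refl b1 (refl b3 v)))
  end.
Proof.
case: l => [] [] []; rewrite /letter /winv /= ?rev_cat ?revK ?act_cat;
  by rewrite ?act_c ?act_rev_c ?act_rev_u ?act_u ?act_c.
Qed.

Let h21 : bform b2 b1 <= -1. Proof. by rewrite (bformC HC). Qed.
Let h31 : bform b3 b1 <= -1. Proof. by rewrite (bformC HC). Qed.
Let h32 : bform b3 b2 <= -1. Proof. by rewrite (bformC HC). Qed.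

Let r1 v : wedge b2 b1 b3 v \/ wedge b3 b1 b2 v -> wedge b1 b2 b3 (refl b1 v).
Proof. by case=> h; [|apply: wedgeC]; apply: wedge_refl => //; left. Qed.
Let r2 v : wedge b1 b2 b3 v \/ wedge b3 b1 b2 v -> wedge b2 b1 b3 (refl b2 v).
Proof. by case=> h; [|apply: wedgeC]; apply: wedge_refl => //; left => //; apply: wedgeC. Qed.
Let r3 v : wedge b1 b2 b3 v \/ wedge b2 b1 b3 v -> wedge b3 b1 b2 (refl b3 v).
Proof. by case=> h; [|apply: wedgeC]; apply: wedge_refl => //; left; apply: wedgeC. Qed.

Lemma zone_gen3 e v : zone (true, e) v -> wedge b3 b1 b2 v.
Proof. by rewrite -{2}(reflK v h3) => h; apply: r3; case: e h; [right|left]. Qed.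

Definition compat l l' := ~~ ((l.1 == l'.1) && (l.2 != l'.2)).

Lemma zone_step l l' v : compat l l' -> zone l' v -> zone l (act (letter l) v).
Proof.
rewrite act_letter; case: l l' => [] [] [] [] [] [] // _ h;
  rewrite /zone ?(reflK _ h3).
- exact/r2/or_introl/r1/or_introl.
- by apply: r2; left; apply: r1; right; apply: r3; right.
- by apply: r2; left; apply: r1; right; apply: r3; left.
- exact/r1/or_introl/r2/or_introl.
- by apply: r1; left; apply: r2; right; apply: r3; right.
- by apply: r1; left; apply: r2; right; apply: r3; left.
- by apply: r2; left; apply: r1; right; apply: (@zone_gen3 true).
- by apply: r2; left; apply: r1; right; apply: (@zone_gen3 false).
- exact/r2/or_introl/r1/or_introl.
- by apply: r1; left; apply: r2; right; apply: (@zone_gen3 true).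
- by apply: r1; left; apply: r2; right; apply: (@zone_gen3 false).
- exact/r1/or_introl/r2/or_introl.
Qed.

Lemma zone_inj l l' v : zone l v -> zone l' v -> l = l'.
Proof.
case: l l' => [] [] [] [] [] [] //= h h'; exfalso.
all: try (move: (@zone_gen3 true v h)); try (move: (@zone_gen3 false v h)).
all: try (move: (@zone_gen3 true v h')); try (move: (@zone_gen3 false v h')).
all: by move: h h'; rewrite /wedge; repeat (case=> ? ? ?); lra.
Qed.

Lemma zone_inhabited l : exists v, zone l v.
Proof.
case: l => [] [] [].
- by exists (refl b3 b2); rewrite /zone (reflK _ h3); split; rewrite ?h2 //; lra.
- by exists (refl b3 b1); rewrite /zone (reflK _ h3); split; rewrite ?h1 //; lra.
- by exists b2; split; rewrite ?h2 //; lra.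
- by exists b1; split; rewrite ?h1 //; lra.
Qed.

Lemma pingpong_free : free_pair m u (c ++ u ++ rev c).
Proof.
move=> w w0 red e.
have key l w' l0 v : reduced2 (l :: w') -> compat (last l w') l0 -> zone l0 v ->
    zone l (act (eval2 u (c ++ u ++ rev c) (l :: w')) v).
  elim: w' l => [|l' w' IH] l red' hc hz.
    by rewrite /eval2 /= cats0 -/(letter l); apply: zone_step hc hz.
  have [h1' h2'] := andP red'.
  rewrite /eval2 /= -/(letter l) act_cat; apply: (zone_step h1').
  exact: IH.
case: w w0 red e => // l w _ red e.
(* The starting zone must be admissible after the last letter and differ from the zone of the first
   letter, so that a word acting as the identity would put a vector in two disjoint zones. *)
have [l0 c0 n0] : exists2 l0, compat (last l w) l0 & l0 != l.
  move: (last l w) => q; case: q (l) => x e1 [x' e']; have [<-|ne] := eqVneq x x'.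
    by exists (~~ x, false); case: x.
  by exists (x', ~~ e'); case: x x' ne e' e1 => [] [] // _ [] [].
have [v hv] := zone_inhabited l0.
have := key _ _ _ _ red c0 hv; rewrite (act_coxeq HB _ e) => hl.
by rewrite (zone_inj hl hv) eqxx in n0.
Qed.

End PingPong.

(** * Families of symmetric forms controlled by the squares of simple roots *)

Section SymmetricSpan.
Variables (R : realType) (S : finType) (B : S -> S -> R).
Hypothesis HC : cartan B.
Local Notation V := {ffun S -> R}.
Local Notation sroot := (sroot R).
Variables (K : Type) (F : K -> V -> V -> R) (G : (K -> R) -> Prop) (X : pred S).
Hypotheses (FC : forall k x y, F k x y = F k y x)
  (FD : forall k x y w, F k (x + y) w = F k x w + F k y w)
  (FZ : forall k a x w, F k (scalev a x) w = a * F k x w).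
(** [G] is a linear space of functions on [K], given up to pointwise equality: in the applications,
    the bounded functions or the zero function. *)
Hypothesis GL : forall a b f g h, (forall k, h k = a * f k + b * g k) -> G f -> G g -> G h.
Hypothesis Grefl : forall s x y, G (F ^~ x ^~ y) ->
  G (fun k => F k (refl B (sroot s) x) (refl B (sroot s) y)).
Hypothesis Gdiag : forall s, s \in X -> G (fun k => F k (sroot s) (sroot s)).
Hypothesis cX : conn_part B X.

Let FDr k x y w : F k w (x + y) = F k w x + F k w y.
Proof. by rewrite FC FD !(FC k w). Qed.
Let FZr k a x w : F k w (scalev a x) = a * F k w x.
Proof. by rewrite FC FZ !(FC k w). Qed.

Let refl_sroot s t : refl B (sroot t) (sroot s) = sroot s + scalev (- 2 * B s t) (sroot t).
Proof. by apply/ffunP => i; rewrite !ffunE bform_sroot; ring. Qed.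

(* The squares of the roots span the symmetric square: reflecting [s.s] in an adjacent [t]
   produces [s.t], and reflecting [s.t] in a neighbour [u] of [t] produces [s.u]. *)
Lemma sym_span s0 x y : s0 \in X -> supp X x -> supp X y -> G (fun k => F k x y).
Proof.
have adj s t : s \in X -> t \in X -> s != t -> B s t < 0 ->
    G (fun k => F k (sroot s) (sroot t)).
  move=> hs ht ne hB; have hB' : B s t != 0 by rewrite lt_eqF.
  have := Grefl t (Gdiag hs).
  rewrite refl_sroot => h.
  have h' : G (fun k => 1 * F k (sroot s) (sroot s) + (4 * B s t ^+ 2) * F k (sroot t) (sroot t)).
    exact: GL (fun k => erefl) (Gdiag hs) (Gdiag ht).
  apply: (GL (a := - (4 * B s t)^-1) (b := (4 * B s t)^-1) _ h h') => k.
  rewrite !(FD, FDr, FZ, FZr) (FC k (sroot t) (sroot s)); field; exact: hB'.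
have pairs s t : s \in X -> t \in X -> G (fun k => F k (sroot s) (sroot t)).
  move=> hs; move: t; apply: cX; first by exists s => //; apply: Gdiag.
  move=> t u ht hu Gst ne hB; have hB' : B t u != 0 by rewrite lt_eqF.
  have Gr := Grefl u Gst; rewrite !refl_sroot in Gr.
  have G1 : G (fun k => 1 * F k (sroot s) (sroot t)
      + (- 2 * B s u) * F k (sroot t) (sroot u)).
    exact: GL (fun k => erefl) Gst (adj _ _ ht hu ne hB).
  have G2 : G (fun k => 1 * (1 * F k (sroot s) (sroot t)
      + (- 2 * B s u) * F k (sroot t) (sroot u))
      + (4 * B s u * B t u) * F k (sroot u) (sroot u)).
    exact: GL (fun k => erefl) G1 (Gdiag hu).
  apply: (GL (a := - (2 * B t u)^-1) (b := (2 * B t u)^-1) _ Gr G2) => k.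
  rewrite !(FD, FDr, FZ, FZr) (FC k (sroot u) (sroot t)); field; exact: hB'.
move=> hs0 sx sy.
have line (L : K -> V -> R) v : (forall k x y, L k (x + y) = L k x + L k y) ->
    (forall k a x, L k (scalev a x) = a * L k x) ->
    (forall s, s \in X -> G (fun k => L k (sroot s))) -> supp X v ->
    G (fun k => L k v).
  move=> LD LZ hL sv.
  have L0 k : L k 0 = 0 by rewrite -(scale0v 0) LZ mul0r.
  rewrite (vec_decomp v); elim/big_rec: _ => [|s y' _ IH].
    by apply: (GL (a := 0) (b := 0) _ (hL _ hs0) (hL _ hs0)) => k; rewrite L0; ring.
  have [hs|hs] := boolP (s \in X).
    apply: (GL (a := v s) (b := 1) _ (hL _ hs) IH) => k; by rewrite LD LZ mul1r.
  by apply: (GL (a := 1) (b := 0) _ IH IH) => k; rewrite LD LZ sv //; ring.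
apply: (line (fun k v => F k v y)) => // s hs.
by apply: (line (fun k v => F k (sroot s) v)) => // t ht; apply: pairs.
Qed.

End SymmetricSpan.

Lemma short_words (T : finType) N : exists l : seq (seq T), forall w, (size w < N)%N -> w \in l.
Proof.
exists (flatten (map (fun k => map (@tval k T) (enum {: k.-tuple T})) (iota 0 N))) => w lt.
apply/flattenP; exists (map (@tval (size w) T) (enum {: (size w).-tuple T})).
  by apply: (map_f (fun k => map (@tval k T) (enum {: k.-tuple T}))); rewrite mem_iota.
by apply/mapP; exists (in_tuple w); rewrite ?mem_enum.
Qed.

(** * Normal subgroups acting nontrivially on a generic component *)

Section Generic.
Variables (R : realType) (S : finType) (m : S -> S -> nat) (B : S -> S -> R).
Hypothesis HB : coxeter_form m B.
Let HC : cartan B := HB.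
Local Notation V := {ffun S -> R}.
Local Notation bform := (bform B).
Local Notation refl := (refl B).
Local Notation sroot := (sroot R).
Local Notation act := (act B).
Implicit Types (v x y b g : V) (s t i j : S) (u w h : seq S).

Variables (H : seq S -> Prop) (X : pred S) (z : V).
Hypotheses (hH : normal_subgroup m H) (hX : closed_part B X) (cX : conn_part B X).
Hypotheses (sz : supp X z) (pz : forall s, s \in X -> 0 < z s).
Hypothesis hz : forall t, t \in X -> bform z (sroot t) < 0.

Let zle t : bform z (sroot t) <= 0.
Proof.
have [ht|ht] := boolP (t \in X); first exact/ltW/hz.
by rewrite (bform_root_supp hX).
Qed.

Definition is_root b := exists w, exists2 s, s \in X & b = act w (sroot s).

Lemma is_root_sroot s : s \in X -> is_root (sroot s).
Proof. by exists [::], s. Qed.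

Lemma is_root_act w b : is_root b -> is_root (act w b).
Proof. by case=> u [s hs ->]; exists (w ++ u), s; rewrite ?act_cat. Qed.

Lemma is_root_norm b : is_root b -> bform b b = 1.
Proof. by case=> w [s _ ->]; rewrite bform_act // bform_rootrr. Qed.

Lemma is_root_supp b : is_root b -> supp X b.
Proof. by case=> w [s hs ->]; apply: supp_act => //; apply: supp_sroot. Qed.

Lemma is_root_word b : is_root b -> exists u, forall v, act u v = refl b v.
Proof.
case=> w [s _ ->]; exists (w ++ [:: s] ++ rev w) => v.
by rewrite act_conj // !act_cat.
Qed.

Lemma is_root_refl b g : is_root b -> is_root g -> is_root (refl b g).
Proof. by move=> /is_root_word[u <-] hg; apply: is_root_act. Qed.

Lemma is_rootN b : is_root b -> is_root (- b).
Proof. by move=> hb; rewrite -(reflb (is_root_norm hb)); apply: is_root_refl. Qed.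

Lemma nonneg_form_dominant v : supp X v -> nonneg v -> v != 0 -> bform v z < 0.
Proof.
move=> sv nv v0; have [i vi] := vec_neq0_ex v0.
have hi : i \in X by apply: contraNT vi => hi; rewrite sv.
rewrite bformEl (bigD1 i) //= -[ltRHS]addr0; apply: ltr_leD.
  by rewrite pmulr_rlt0 ?lt0r ?vi ?nv // (bformC HC) hz.
by apply: sumr_le0 => j _; rewrite mulr_ge0_le0 // (bformC HC).
Qed.

Lemma root_form_dominant b : is_root b -> bform b z != 0.
Proof.
move=> hb; have b0 : b != 0.
  by apply/eqP => b0; have := is_root_norm hb; rewrite b0 bform0l => /eqP; rewrite eq_sym oner_eq0.
have sb := is_root_supp hb; case: (hb) => w [s hs eb].
have [nb|nb] := nonneg_or HB w s; rewrite -eb in nb.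
  by rewrite lt_eqF // nonneg_form_dominant.
have : bform (- b) z < 0 by apply: nonneg_form_dominant; rewrite ?oppr_eq0 //; apply: suppN.
by rewrite bformNl oppr_lt0 => h; rewrite gt_eqF.
Qed.

Lemma act_form_le w : bform (act w z) z <= bform z z.
Proof.
rewrite -subr_le0 -bformBl bformEl; apply: sumr_le0 => i _.
by rewrite mulr_ge0_le0 ?(act_dominant_ge HB zle) // (bformC HC).
Qed.

Lemma act_form_lt w : act w z != z -> bform (act w z) z < bform z z.
Proof.
rewrite -subr_eq0 => ne; rewrite -subr_lt0 -bformBl; apply: nonneg_form_dominant => //.
  by apply: suppB => //; apply: supp_act.
exact: (act_dominant_ge HB zle).
Qed.

(** [z] maximizes [<w z|z>] over the group, and twice [qdih] is the drop from this maximum under a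
    conjugate of [r_b r_g]. *)
Lemma qdih_ge0 b g w : is_root b -> is_root g -> 0 <= qdih B b g (act w z).
Proof.
move=> hb hg; have [u1 e1] := is_root_word hb; have [u2 e2] := is_root_word hg.
have := bform_refl2 HC (act w z) (is_root_norm hb) (is_root_norm hg).
rewrite -e2 -e1 [bform (act w z) (act w z)]bform_act //.
rewrite -[LHS](bform_act HC (rev w)) (actK HC) -!act_cat => e.
by have := act_form_le (((rev w ++ u1) ++ u2) ++ w); rewrite e; lra.
Qed.

(** Equality would mean that [r_b r_g] fixes [z]; as [z] is orthogonal to no root, [g] would then be
    a multiple of [b]. *)
Lemma qdih_gt0 b g : is_root b -> is_root g -> bform b g ^+ 2 != 1 -> 0 < qdih B b g z.
Proof.
move=> hb hg ne; have [u1 e1] := is_root_word hb; have [u2 e2] := is_root_word hg.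
have := bform_refl2 HC z (is_root_norm hb) (is_root_norm hg).
rewrite -e2 -e1 -act_cat => e.
suff : act (u1 ++ u2) z != z by move=> /act_form_lt; rewrite e; lra.
apply: contraNneq ne; rewrite act_cat e1 e2 => /(congr1 (refl b)).
rewrite (reflK _ (is_root_norm hb)) /refl => e'.
have {}e' : scalev (2 * bform z g) g = scalev (2 * bform z b) b.
  have := congr1 (fun v => z - v) e'; rewrite !opprB !addrA.
  by rewrite ![z + _]addrC !addrK.
have [r eg] : exists r, g = scalev r b.
  have zg : bform z g != 0 by rewrite (bformC HC) root_form_dominant.
  exists (bform z b / bform z g).
  apply/ffunP => i; have := congr1 (fun f : V => f i) e'; rewrite !ffunE => h.
  have k : 2 * bform z g != 0 :> R by rewrite mulf_neq0 ?pnatr_eq0.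
  by apply: (mulfI k); rewrite h; field.
have := is_root_norm hg; rewrite eg !(bformZl, bformZr HC) (is_root_norm hb) => er.
by apply/eqP; rewrite -[RHS]er; ring.
Qed.

(** The entries of [B] are at most 1, so [<v|v>] is at most the square of the coordinate sum. *)
Lemma coord_sum_ge1 v : nonneg v -> bform v v = 1 -> 1 <= coord_sum v.
Proof.
move=> nv e; have : 1 <= coord_sum v * coord_sum v.
  rewrite -e /bform /coord_sum mulr_suml; apply: ler_sum => i _.
  rewrite mulr_sumr; apply: ler_sum => j _; apply: ler_piMr; first by rewrite mulr_ge0.
  have [->|ne] := eqVneq i j; first by rewrite (cartan_diag HC).
  exact: le_trans (cartan_le0 HC ne) ler01.
have := coord_sum_ge0 nv => t0; rewrite -expr2 => h.
by rewrite -(@ler_pXn2r _ 2) ?nnegrE // expr1n.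
Qed.

Lemma dominant_gap : exists2 d : R, 0 < d & forall t, t \in X -> bform z (sroot t) <= - d.
Proof.
exists (\big[Order.min/1]_(t in X) - bform z (sroot t)).
  by apply: lt_bigmin => // t ht; rewrite oppr_gt0 hz.
by move=> t ht; rewrite lerNr; apply: bigmin_le_cond.
Qed.

(** Each letter in [X] of a reduced word raises the coordinate sum of [w z] by at least [2 d], and
    [-<w z|z>] is at least [d] times that sum. The bound [K] thus allows at most [K / (2 d^2)]
    letters in [X], which leaves finitely many actions. *)
Lemma bounded_image_trivial K : (forall h, H h -> - K <= bform (act h z) z) ->
  forall h s, H h -> s \in X -> act h (sroot s) = sroot s.
Proof.
move=> hK; have [d d0 hd] := dominant_gap.
have size_bound w : reduced_word m w ->
    (size (filter X w))%:R * (2 * d) <= coord_sum (act w z).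
  elim/last_ind: w => [_|w s IH red].
    rewrite mul0r; apply: coord_sum_ge0 => i; have [hi|hi] := boolP (i \in X).
      exact/ltW/pz.
    by rewrite sz.
  have red' : reduced_word m w by apply: (@reduced_catl _ _ _ [:: s]); rewrite cats1.
  rewrite filter_rcons act_rcons /refl; case: ifP => hs; last first.
    rewrite (bform_root_supp hX) // ?unfold_in ?hs //.
    by rewrite mulr0 scale0v subr0; apply: IH.
  rewrite actB actZ -scaleN1v !coord_sumD !coord_sumZ size_rcons -natr1 mulrDl.
  apply: lerD; first exact: IH.
  have t1 : 1 <= coord_sum (act w (sroot s)).
    by apply: coord_sum_ge1; [apply: (reduced_rcons_nonneg HB) | rewrite bform_act // bform_rootrr].
  have := hd s hs; nra.
have form_bound w : d * coord_sum (act w z) <= - bform (act w z) z.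
  have sw : supp X (act w z) by apply: supp_act.
  rewrite (bformEX _ _ sw) /coord_sum mulr_sumr (bigID [in X]) /= [X in _ + X]big1 => [|i hi]; last first.
    by rewrite sw // mulr0.
  rewrite addr0 -sumrN; apply: ler_sum => i hi.
  have : 0 <= act w z i.
    have := act_dominant_ge HB zle w i; rewrite !ffunE; have := pz hi; lra.
  have := hd i hi; rewrite (bformC HC); nra.
pose N := Num.bound (K / (2 * d ^+ 2)).
have [l hl] := short_words S N.
apply: (finite_image_trivial HB hH hX cX sz pz zle (l := l)) => h Hh.
have [w hw red] := exists_reduced m h.
exists (filter X w); last first.
  by move=> s hs; rewrite (act_coxeq HB _ hw) act_filter //; apply: supp_sroot.
apply: hl; rewrite -(ltr_nat R) /N.
have h1 := size_bound w red; have h2 := form_bound w.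
have h3 := hK h Hh; rewrite (act_coxeq HB _ hw) in h3.
have h4 : (size (filter X w))%:R <= K / (2 * d ^+ 2).
  rewrite ler_pdivlMr; last by rewrite mulr_gt0 // exprn_gt0.
  have := ler_wpM2l (ltW d0) h1; lra.
apply: (le_lt_trans h4); apply: archi_boundP.
exact: le_trans (ler0n _ _) h4.
Qed.

Hypothesis nontriv : exists h s, [/\ H h, s \in X & act h (sroot s) != sroot s].

(** Boundedness on the squares of simple roots would spread to [<h z|z>]; normality gives the
    stability under reflections. [F] symmetrizes [<h x|y>], which is not symmetric in [x] and
    [y]. *)
Lemma unbounded_diag (C : R) : exists h s,
  [/\ H h, s \in X & C < `|bform (act h (sroot s)) (sroot s)|].
Proof.
apply: contrapT => no; case: nontriv => h0 [s0 [Hh0 hs0 /eqP[]]].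
have bd h s : H h -> s \in X -> `|bform (act h (sroot s)) (sroot s)| <= C.
  by move=> Hh hs; rewrite leNgt; apply/negP => lt; apply: no; exists h, s.
pose F h x y := bform (act h x) y + bform (act h y) x.
pose G (f : seq S -> R) := exists C', forall h, H h -> `|f h| <= C'.
have [C' hC'] : G (fun h => F h z z).
  apply: (@sym_span R S B _ F G X _ _ _ _ _ _ cX s0 z z) => //.
  - by move=> h x y; rewrite /F addrC.
  - by move=> h x y w; rewrite /F actD !(bformE HC); ring.
  - by move=> h a x w; rewrite /F actZ !(bformE HC); ring.
  - move=> a b f g k ek [Cf hf] [Cg hg]; exists (`|a| * Cf + `|b| * Cg) => h Hh.
    rewrite ek; apply: le_trans (ler_normD _ _) _; rewrite !normrM.
    by apply: lerD; apply: ler_wpM2l => //; [apply: hf | apply: hg].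
  - move=> s x y [C' hC']; exists C' => h Hh; apply: le_trans (hC' _ (normal_conj hH [:: s] Hh)).
    have e x' y' : bform (act h (refl (sroot s) x')) (refl (sroot s) y') =
        bform (act ([:: s] ++ h ++ [:: s]) x') y'.
      by rewrite !act_cat [RHS](bform_actl HC).
    by rewrite /F !e.
  - move=> s hs; exists (C + C) => h Hh; apply: le_trans (ler_normD _ _) _.
    by apply: lerD; apply: bd.
apply: (bounded_image_trivial (K := C')) Hh0 hs0 => h Hh.
have := hC' h Hh; rewrite /F => hh.
have := ler_norm (- (bform (act h z) z + bform (act h z) z)); rewrite normrN.
have := normr_ge0 (bform (act h z) z + bform (act h z) z); lra.
Qed.

(** Reflecting [g] in a neighbour [b] of [a] changes [<g|a>] by [2 <g|b> B a b], so a bound at [a]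
    yields one at [b]. By connectedness all simple roots would be bounded, against
    [unbounded_diag]. *)
Lemma root_unbounded t : t \in X -> forall C, exists2 g, is_root g & C < `|bform g (sroot t)|.
Proof.
pose bd s := exists C, forall g, is_root g -> `|bform g (sroot s)| <= C.
suff nb s : s \in X -> ~ bd s.
  move=> ht C; apply: contrapT => no; apply: (nb t ht); exists C => g hg.
  by rewrite leNgt; apply/negP => lt; apply: no; exists g.
move=> hs bs.
have all_bd : forall t, t \in X -> bd t.
  apply: cX; first by exists s.
  move=> a b ha hb [C hC] ne hB; exists (C / `|B a b|) => g hg.
  rewrite ler_pdivlMr; last by rewrite normr_gt0 lt_eqF.
  have := hC _ (is_root_refl (is_root_sroot hb) hg); have := hC _ hg.
  rewrite bform_refll bform_sroot (cartan_sym HC b a) -normrM.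
  set p := bform g (sroot a); set q := bform g (sroot b) * B a b => h1 h2.
  have := ler_normB p (p - 2 * bform g (sroot b) * B a b).
  have -> : p - (p - 2 * bform g (sroot b) * B a b) = 2 * q by rewrite /q; ring.
  by rewrite normrM (ger0_norm (ler0n R 2)); lra.
have [f hf] : exists f : S -> R, forall t, t \in X -> forall g, is_root g ->
    `|bform g (sroot t)| <= f t.
  apply: (@fin_all_exists _ _ (fun t (c : R) => t \in X -> forall g, is_root g ->
    `|bform g (sroot t)| <= c)) => a.
  by have [/all_bd[C hC]|_] := boolP (a \in X); [exists C | exists 0].
have [h [a [Hh ha lt]]] := unbounded_diag (\sum_(a in X) `|f a|).
have := hf a ha _ (is_root_act h (is_root_sroot ha)).
have := ler_norm (f a); have : `|f a| <= \sum_(a in X) `|f a|.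
  by rewrite (bigD1 a) //= lerDl; apply: sumr_ge0.
by lra.
Qed.

Section Axis.
Variables (b1 b2 : V) (t : R).
Hypotheses (r1 : is_root b1) (r2 : is_root b2) (t1 : 1 < t).
Hypothesis h12 : bform b1 b2 = - ((t + t^-1) / 2).
Local Notation e1 := (axis b1 b2 t).
Local Notation e2 := (axis' b1 b2 t).
Let Q v : R := bform v e1 * bform v e2.

Let QN v : Q (- v) = Q v.
Proof. by rewrite /Q !bformNl mulrNN. Qed.

Let Q_z w : 0 <= Q (act w z).
Proof.
rewrite /Q -(qdih_axis HC t1 h12); exact: qdih_ge0.
Qed.

Hypothesis Qroot : forall g, is_root g -> Q g <= 0.

(** [Q] is nonpositive on the roots and nonnegative on the orbit of [z]. Under [r_b r_g] the root
    [b] and the vector [z] both approach the line of the axis, so both signs hold there. *)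
Let Q_axis b g p : is_root b -> is_root g -> 1 < p ->
  bform b g = - ((p + p^-1) / 2) -> Q (axis b g p) = 0.
Proof.
move=> hb hg p1 hbg.
have p0 : p != 0 by rewrite gt_eqF // (lt_trans ltr01).
have nb := is_root_norm hb; have ng := is_root_norm hg.
have /andP[i0 i1] := inv_lt1 p1.
apply/eqP; rewrite eq_le; apply/andP; split.
  rewrite -oppr_ge0 -mulN1r.
  apply: (axis_sign HC nb ng p1 hbg (P := is_root) (v := b)) => //.
  - by move=> x hx; apply/is_root_refl/is_root_refl.
  - by move=> x hx; rewrite mulN1r oppr_ge0; apply: Qroot.
  rewrite (bformDr HC) (bformZr HC) hbg nb; apply/eqP => e; lra.
rewrite -[X in _ <= X]mul1r.
apply: (axis_sign HC nb ng p1 hbg (P := fun x => exists w, x = act w z) (v := z)).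
- by exists [::].
- have [u1 eu1] := is_root_word hb; have [u2 eu2] := is_root_word hg.
  by move=> x [w ->]; exists (u1 ++ u2 ++ w); rewrite !act_cat eu1 eu2.
- by move=> x [w ->]; rewrite mul1r; apply: Q_z.
have /gt_eqF : 0 < qdih B b g z.
  apply: qdih_gt0 => //; rewrite hbg sqrrN gt_eqF // exprn_egt1 //.
  rewrite ltr_pdivlMr // mul1r -subr_gt0.
  have -> : p + p^-1 - 2 = (p - 1) ^+ 2 * p^-1 by field.
  by rewrite mulr_gt0 // exprn_gt0 // subr_gt0.
rewrite (qdih_axis HC p1 hbg) => /negbT; rewrite mulf_eq0 negb_or => /andP[_].
by [].
Qed.

(** [Q] vanishes at [g + p b] and at [b + p g]. Subtracting the two expansions removes the mixed
    term and leaves [(1 - p^2) (Q b - Q g) = 0]. *)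
Let Q_adj b g : is_root b -> is_root g -> 1 < `|bform b g| -> Q b = Q g.
Proof.
wlog hneg : g / bform b g < 0 => [wl hb hg h|hb hg h].
  have [lt|ge] := ltP (bform b g) 0; first exact: wl.
  rewrite -(QN g); apply: wl => //; last by rewrite (bformNr HC) normrN.
    rewrite (bformNr HC) oppr_lt0; move: h; rewrite ger0_norm // => h.
    exact: lt_trans ltr01 h.
  exact: is_rootN.
rewrite ltr0_norm // in h; have [p p1 ep] := hyperbolic_param h.
have hbg : bform b g = - ((p + p^-1) / 2) by rewrite -ep opprK.
have hgb : bform g b = - ((p + p^-1) / 2) by rewrite (bformC HC).
have := Q_axis hb hg p1 hbg; have := Q_axis hg hb p1 hgb.
rewrite /Q [axis g b p]/axis [axis b g p]/axis !(bformDl, bformZl) => E1 E2.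
have p2 : 1 - p ^+ 2 != 0 by rewrite subr_eq0 lt_eqF // exprn_egt1.
by apply: (mulfI p2); move: E1 E2; move: (bform b _) (bform b _) (bform g _) (bform g _) => x y x' y'; lra.
Qed.

Let Q_simple w s s' : s \in X -> s' \in X -> Q (act w (sroot s)) = Q (act w (sroot s')).
Proof.
move=> hs; move: s'; apply: cX; first by exists s.
move=> a b ha hb -> ne hB.
have nB : 0 < `|B a b| by rewrite normr_gt0 lt_eqF.
(* Two simple roots are linked through a root having large products with both. If [<g|a_b>] is at
   most 1 in absolute value, [r_a g] replaces [g]: the constant makes [2 |<g|a_a>| |B a b|] exceed
   4, so more than 1 remains. *)
have [g hg lt] := root_unbounded ha (2 + 2 / `|B a b|).
have wg g' : is_root g' -> forall c, c \in X -> 1 < `|bform g' (sroot c)| ->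
    Q (act w (sroot c)) = Q (act w g').
  move=> hg' c hc h; apply: Q_adj; [exact/is_root_act/is_root_sroot|exact: is_root_act|].
  by rewrite bform_act // (bformC HC).
have p0 : 0 <= 2 / `|B a b| by rewrite divr_ge0.
have gt1 : 1 < `|bform g (sroot a)| by lra.
have [big|small] := ltP 1 `|bform g (sroot b)|.
  by rewrite (wg g hg a ha gt1) (wg g hg b hb big).
have hg' : is_root (refl (sroot a) g) by apply: is_root_refl => //; apply: is_root_sroot.
rewrite (wg _ hg' a ha) ?(wg _ hg' b hb) //.
  rewrite bform_refll bform_sroot.
  have := lerB_normD (- (2 * bform g (sroot a) * B a b)) (bform g (sroot b)).
  rewrite addrC normrN !normrM (ger0_norm (ler0n R 2)) => h.
  rewrite addrC; apply: lt_le_trans h.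
  have : (2 + 2 / `|B a b|) * `|B a b| < `|bform g (sroot a)| * `|B a b| by rewrite ltr_pM2r.
  have -> : (2 + 2 / `|B a b|) * `|B a b| = 2 * `|B a b| + 2 by field; rewrite gt_eqF.
  lra.
rewrite bform_refll bform_rootrr //.
have -> : bform g (sroot a) - 2 * bform g (sroot a) * 1 = - bform g (sroot a) by ring.
by rewrite normrN.
Qed.

(** [Q_simple] exchanges [s] for the last letter [a] of the word, which then only negates its own
    root. *)
Let Q_const b : is_root b -> Q b = Q b1.
Proof.
have key s0 : s0 \in X -> forall w s, s \in X -> Q (act w (sroot s)) = Q (sroot s0).
  move=> hs0 w; elim/last_ind: w => [|w a IH] s hs; first exact: (Q_simple [::]).
  have [ha|ha] := boolP (a \in X).
    rewrite (Q_simple (rcons w a) hs ha) act_rcons (reflb (bform_rootrr HC a)) actN QN.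
    exact: IH.
  by rewrite act_rcons refl_fix ?IH // (bform_root_supp hX) //; apply: supp_sroot.
move=> [w [s hs ->]]; case: r1 => w1 [s1 hs1 ->].
by rewrite (key s hs w s hs) (key s hs w1 s1 hs1).
Qed.

(* If [Q] were nowhere positive on the roots, it would vanish on the isotropic axes of every
   infinite dihedral pair, hence be constant on the roots, hence be a multiple of [B]; this
   is incompatible with the products of [z] with the simple roots being negative. *)
Lemma no_axis_root : False.
Proof.
set q0 := Q b1.
have q0_lt : q0 < 0.
  rewrite /q0 /Q !(bformDr HC) !(bformZr HC) h12 (is_root_norm r1).
  have /andP[i0 i1] := inv_lt1 t1.
  have -> : (- ((t + t^-1) / 2) + t * 1) * (- ((t + t^-1) / 2) + t^-1 * 1) =
    - ((t - t^-1) / 2) ^+ 2 by field; rewrite gt_eqF // (lt_trans ltr01).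
  by rewrite oppr_lt0 exprn_gt0 // divr_gt0 // subr_gt0 (lt_trans i1).
have [s0 hs0] : exists s, s \in X by case: r1 => w [s hs _]; exists s.
have form_eq x y : supp X x -> supp X y ->
    bform x e1 * bform y e2 + bform y e1 * bform x e2 = 2 * q0 * bform x y.
  move=> sx sy.
  (* Letting [w] vary makes the vanishing of [F] stable under reflections, as [sym_span] requires;
     on the square of a simple root it is the constancy of [Q]. *)
  pose F w x y := bform (act w x) e1 * bform (act w y) e2 +
    bform (act w y) e1 * bform (act w x) e2 - 2 * q0 * bform x y.
  have : forall w, F w x y = 0.
    apply: (@sym_span R S B _ F (fun f => forall w, f w = 0) X _ _ _ _ _ _ cX s0 x y) => //.
    - by move=> w x' y'; rewrite /F (bformC HC x'); ring.
    - by move=> w x' y' v; rewrite /F actD !(bformE HC); ring.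
    - by move=> w a x' y'; rewrite /F actZ !(bformE HC); ring.
    - by move=> a b f g k ek hf hg w; rewrite ek hf hg !mulr0 addr0.
    - by move=> s x' y' h w; have := h (rcons w s); rewrite /F !act_rcons bform_refl ?bform_rootrr.
    - move=> s hs w; rewrite /F bform_rootrr //.
      have : Q (act w (sroot s)) = q0 by apply/Q_const/is_root_act/is_root_sroot.
      by rewrite /Q => ->; ring.
  by move=> /(_ [::]); rewrite /F /= => /eqP; rewrite subr_eq0 => /eqP.
pose X1 s := bform (sroot s) e1; pose X2 s := bform (sroot s) e2.
have Xs s : s \in X -> X1 s * X2 s = q0.
  by move=> hs; rewrite -[LHS]/(Q _); apply/Q_const/is_root_sroot.
have Zs s : s \in X -> 0 < bform z e1 * X2 s + X1 s * bform z e2.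
  move=> hs; rewrite form_eq //; last exact: supp_sroot.
  by rewrite nmulr_rgt0 ?hz // pmulr_rlt0.
(* For two simple roots, [form_eq] gives [x^2 + x'^2 = 2 B x x'] with [-1 <= B <= 0], which forces
   [x' = -x] and likewise [y' = -y]. The two positive quantities in [Zs] would then be opposite. *)
have uniqX s : s \in X -> s = s0.
  move=> hs; apply/eqP; apply: contraT => ne; exfalso.
  have e := form_eq _ _ (supp_sroot R hs) (supp_sroot R hs0).
  rewrite bform_sroot -!/(X1 _) -!/(X2 _) in e.
  have Bn := cartan_le0 HC ne; have Bp := cartan_geN1 HC s s0.
  have := Zs _ hs; have := Zs _ hs0; have := Xs _ hs; have := Xs _ hs0.
  move: e; set x := X1 s; set x' := X1 s0; set y := X2 s; set y' := X2 s0.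
  move=> e E' E.
  have x0 : x != 0 by apply/eqP => x0; move: E q0_lt; rewrite x0 mul0r => <-; rewrite ltxx.
  have x'0 : x' != 0 by apply/eqP => x0'; move: E' q0_lt; rewrite x0' mul0r => <-; rewrite ltxx.
  have sq : x ^+ 2 + x' ^+ 2 = 2 * B s s0 * (x * x').
    have q00 : q0 != 0 by rewrite lt_eqF.
    apply: (mulfI q00).
    have -> : q0 * (2 * B s s0 * (x * x')) = (2 * q0 * B s s0) * (x * x') by ring.
    by rewrite -e mulrDr -{1}E' -E; ring.
  have x2 : 0 < x ^+ 2 by rewrite exprn_even_gt0.
  have x'2 : 0 < x' ^+ 2 by rewrite exprn_even_gt0.
  have xx : x * x' < 0 by nra.
  have sum0 : (x + x') ^+ 2 <= 0 by rewrite sqrrD mulr2n; nra.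
  have ex : x' = - x.
    by apply/eqP; rewrite -addr_eq0 addrC -sqrf_eq0 eq_le sum0 sqr_ge0.
  have ey : y' = - y.
    by apply: (mulfI x0); apply: oppr_inj; rewrite mulrN opprK -mulNr -ex E' E.
  rewrite ex ey; lra.
have ez : z = scalev (z s0) (sroot s0).
  apply/ffunP => i; rewrite !ffunE; have [->|ne] := eqVneq i s0; first by rewrite mulr1.
  rewrite mulr0 sz //; apply/negP => /uniqX e; by rewrite e eqxx in ne.
have := hz hs0; rewrite ez bformZl bform_rootrr // mulr1 => h.
by have := pz hs0; rewrite ltNge ltW.
Qed.

End Axis.

Lemma generic_not_narrow : ~ narrow m H.
Proof.
have [h [s [Hh hs lt]]] := unbounded_diag 1.
set b1 := sroot s.
have rb1 : is_root b1 by apply: is_root_sroot.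
have [b2 [rb2 eb2 lt12]] : exists b2, [/\ is_root b2,
    forall v w, refl (act w b2) v = refl (act w (act h b1)) v & 1 < - bform b1 b2].
  have rh : is_root (act h b1) by apply: is_root_act.
  have [neg|pos] := ltP (bform (act h b1) b1) 0.
    by exists (act h b1); split => //; rewrite (bformC HC) -ltr0_norm.
  exists (- act h b1); split; first exact: is_rootN.
    by move=> v w; rewrite actN reflNb.
  by rewrite (bformNr HC) opprK (bformC HC) -(ger0_norm pos).
have [t t1 et] := hyperbolic_param lt12.
have h12 : bform b1 b2 = - ((t + t^-1) / 2) by rewrite -et opprK.
have n1 := is_root_norm rb1; have n2 := is_root_norm rb2.
have [b3 [rb3 x0 y0]] : exists b3, [/\ is_root b3, bform (axis b1 b2 t) b3 < 0
    & bform (axis' b1 b2 t) b3 < 0].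
  have [b [rb pos]] : exists b, is_root b /\ 0 < bform b (axis b1 b2 t) * bform b (axis' b1 b2 t).
    apply: contrapT => no; apply: (no_axis_root rb1 rb2 t1 h12) => g hg.
    by rewrite leNgt; apply/negP => hlt; apply: no; exists g.
  rewrite !(bformC HC b) in pos; have [neg|] := ltP (bform (axis b1 b2 t) b) 0.
    by exists b; split => //; rewrite nmulr_rgt0 in pos.
  rewrite le_eqVlt => /orP[/eqP e|pos']; first by rewrite -e mul0r ltxx in pos.
  exists (- b); split; rewrite ?(bformNr HC) ?oppr_lt0 //; first exact: is_rootN.
  by rewrite pmulr_rgt0 in pos.
pose G v := refl b1 (refl b2 v).
pose rh := h ++ [:: s] ++ rev h.
pose gw := [:: s] ++ rh.
pose pw n := flatten (nseq n gw).
have act_gw v : act gw v = G v.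
  rewrite /gw /rh !act_cat /G -[refl b2 v]/(refl (act [::] b2) v) eb2 /=.
  by rewrite act_conj.
have act_pw n v : act (pw n) v = iter n G v.
  elim: n v => [|n IH] v; first by [].
  by rewrite -[pw n.+1]/(gw ++ pw n) act_cat act_gw IH iterS.
(* Regrouped as [(s h s) h^-1], a product of two elements of [H] by normality. *)
have Hgw : H gw.
  rewrite -[gw]/([:: s] ++ (h ++ [:: s] ++ rev h)) [h ++ _]catA catA.
  by apply: (normal_cat hH); [apply: (normal_conj hH [:: s]) | apply: (normal_rev hH)].
have Hpw n : H (pw n).
  by elim: n => [|n IH]; [apply: (normal_nil hH) | apply: (normal_cat hH)].
have [n [nx ny]] : exists n,
    ((t ^+ 2) ^+ n * bform (axis b1 b2 t) b3 - (t ^+ 2) ^- n * bform (axis' b1 b2 t) b3) / (t - t^-1) <= -1 /\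
    (t * (t ^+ 2) ^+ n * bform (axis' b1 b2 t) b3 - (t ^+ 2) ^- n * t^-1 * bform (axis b1 b2 t) b3) / (t - t^-1) <= -1.
  move: x0 y0; set x := bform _ b3; set y := bform _ b3 => x0 y0.
  have /andP[i0 i1] := inv_lt1 t1.
  have d0 : 0 < t - t^-1 by rewrite subr_gt0 (lt_trans i1).
  (* Besides the required [t - t^-1], [K] absorbs the terms in [x] and [y] whose factors [p^-1] and
     [p^-1 t^-1] are below 1. *)
  set K := (- x - y + (t - t^-1)).
  have K0 : 0 < K by rewrite /K; lra.
  have [n hn] := pow_unbounded t1 (1 + K / (- x) + K / (- y)).
  exists n; set p := (t ^+ 2) ^+ n in hn *.
  have kx : 0 < K / (- x) by rewrite divr_gt0 // oppr_gt0.
  have ky : 0 < K / (- y) by rewrite divr_gt0 // oppr_gt0.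
  have px : K < p * (- x) by rewrite -ltr_pdivrMr ?oppr_gt0 //; lra.
  have py : K < p * (- y) by rewrite -ltr_pdivrMr ?oppr_gt0 //; lra.
  have p1 : 1 < p by lra.
  have /andP[j0 j1] : 0 < p^-1 < 1 by apply: inv_lt1.
  rewrite !ler_pdivrMr //; rewrite /K in px py; split; first nra.
  have j2 : 0 < p^-1 * t^-1 < 1.
    by rewrite mulr_gt0 //= -[1]mulr1 ltr_pM // ltW.
  have /andP[j3 j4] := j2; nra.
(* The ping-pong triple is [b1], [gw^(-2n) b2], [gw^(-n) b3]: all three pairings tend to
   minus infinity with [n]. *)
pose eta := rev (pw (n + n)) ++ h.
pose u := [:: s] ++ (eta ++ [:: s] ++ rev eta).
have Heta : H eta by apply: (normal_cat hH) => //; apply: (normal_rev hH).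
have Hu : H u.
  rewrite /u [eta ++ _]catA catA.
  by apply: (normal_cat hH); [apply: (normal_conj hH [:: s]) | apply: (normal_rev hH)].
have [c hc] := is_root_word (is_root_act (rev (pw n)) rb3).
move=> nar; apply: nar; exists u, (c ++ u ++ rev c); split => //.
  exact: (normal_conj hH).
apply: (@pingpong_free R S m B HB b1 (act (rev (pw (n + n))) b2) (act (rev (pw n)) b3) u c) => //.
- by rewrite bform_act.
- by rewrite bform_act // is_root_norm.
- by rewrite -(bform_actl HC) act_pw; exact: (dihedral_iter_bg HC n1 n2 t1 h12).
- by rewrite -(bform_actl HC) act_pw (dihedral_iter_b HC n1 n2 t1 h12).
- have -> : pw (n + n) = pw n ++ pw n by rewrite /pw nseqD flatten_cat.
  rewrite rev_cat act_cat bform_act // (bformC HC) -(bform_actl HC) act_pw.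
  by rewrite (dihedral_iter_g HC n1 n2 t1 h12).
- by move=> v; rewrite eb2 -act_cat -/eta act_conj // /u !act_cat.
Qed.

End Generic.

(** * Growth in the positive semidefinite case *)

Section SumOfSquares.
Variables (R : realType) (S : finType).
Local Notation V := {ffun S -> R}.
Implicit Types (M : S -> S -> R).

Definition sym_psd M := (forall i j, M i j = M j i) /\ forall v : V, 0 <= bform M v v.

Lemma bform_addZ M v s a : (forall i j, M i j = M j i) ->
  bform M (v + scalev a (sroot R s)) (v + scalev a (sroot R s)) =
  bform M v v + 2 * a * bform M v (sroot R s) + a ^+ 2 * M s s.
Proof.
move=> sM; rewrite bformDl bformZl ![bform M _ (v + _)](bform_symm _ _ sM).
rewrite !bformDl !bformZl (bform_symm (sroot R s) v sM) bform_sroot; ring.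
Qed.

(** Lagrange reduction: each index with a nonzero diagonal entry is removed by splitting off one
    square. *)
Lemma sum_of_squares_partial M (l : seq S) : sym_psd M -> exists (L : seq V) M',
  [/\ sym_psd M', forall i j, i \in l -> M' i j = 0 &
      forall v, bform M v v = \sum_(f <- L) dot f v ^+ 2 + bform M' v v].
Proof.
move=> pM; elim: l => [|s l [L [M' [[sM pM'] zM eM]]]].
  by exists [::], M; split => // v; rewrite big_nil add0r.
have qs : 0 <= M' s s by rewrite -bform_sroot.
have [e0|ne0] := eqVneq (M' s s) 0.
  exists L, M'; split => // i j; rewrite inE => /orP[/eqP ->|]; last exact: zM.
  apply/eqP; apply: contraT => nz.
  (* A zero diagonal entry forces a zero row: otherwise the form takes the value [-1] at this
     vector. *)
  have := pM' (sroot R j + scalev (- (M' j j + 1) / (2 * M' s j)) (sroot R s)).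
  rewrite bform_addZ // !bform_sroot e0 (sM j s) mulr0 addr0.
  have -> : 2 * (- (M' j j + 1) / (2 * M' s j)) * M' s j = - (M' j j + 1) by field.
  lra.
have ps : 0 < M' s s by rewrite lt0r ne0.
pose f : V := [ffun i => M' s i / Num.sqrt (M' s s)].
pose M2 i j := M' i j - M' s i * M' s j / M' s s.
have sq : Num.sqrt (M' s s) ^+ 2 = M' s s by rewrite sqr_sqrtr.
have rt0 : Num.sqrt (M' s s) != 0 by rewrite gt_eqF // sqrtr_gt0.
have df v : dot f v ^+ 2 = bform M' v (sroot R s) ^+ 2 / M' s s.
  have -> : dot f v = bform M' v (sroot R s) / Num.sqrt (M' s s).
    rewrite /dot bformEl mulr_suml; apply: eq_bigr => i _.
    by rewrite ffunE bform_sroot (sM i s); ring.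
  by rewrite expr_div_n sq.
have e2 v : bform M2 v v = bform M' v v - dot f v ^+ 2.
  have hc : bform M' v (sroot R s) = \sum_i v i * M' s i.
    by rewrite bformEl; apply: eq_bigr => i _; rewrite bform_sroot (sM i s).
  rewrite df hc expr2 big_distrlr /= mulr_suml /bform -sumrB; apply: eq_bigr => i _.
  rewrite mulr_suml -sumrB; apply: eq_bigr => j _.
  by rewrite /M2; ring.
exists (f :: L), M2; split.
- split=> [i j|v]; first by rewrite /M2 (sM i j); ring.
  have := pM' (v + scalev (- bform M' v (sroot R s) / M' s s) (sroot R s)).
  rewrite bform_addZ // e2 df; congr (0 <= _); field; exact: ne0.
- move=> i j; rewrite inE => /orP[/eqP ->|hi]; rewrite /M2; first by field.
  by rewrite (sM s i) !(zM i) //; ring.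
by move=> v; rewrite eM e2 big_cons; ring.
Qed.

Lemma sum_of_squares M : sym_psd M ->
  exists L : seq V, forall v, bform M v v = \sum_(f <- L) dot f v ^+ 2.
Proof.
move=> /(sum_of_squares_partial (enum S))[L [M' [_ zM e]]]; exists L => v.
rewrite e [bform M' v v]big1 ?addr0 // => i _; apply: big1 => j _.
by rewrite zM ?mem_enum // mulr0.
Qed.

Lemma psdef_sum_of_squares (B : S -> S -> R) (Y : pred S) : cartan B -> psdef B Y ->
  exists L : seq V, forall v, supp Y v -> bform B v v = \sum_(f <- L) dot f v ^+ 2.
Proof.
move=> HC pY; pose M i j := if (i \in Y) && (j \in Y) then B i j else 0.
have eM v : supp Y v -> bform M v v = bform B v v.
  move=> sv; apply: eq_bigr => i _; apply: eq_bigr => j _.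
  rewrite /M; case: ifP => // /negbT; rewrite negb_and => /orP[]/sv ->; ring.
have [|L eL] := @sum_of_squares M; last by exists L => v sv; rewrite -eM.
split=> [i j|v]; first by rewrite /M andbC (cartan_sym HC).
pose v' : V := [ffun i => if i \in Y then v i else 0].
have sv : supp Y v' by move=> i /negbTE hi; rewrite ffunE hi.
have -> : bform M v v = bform M v' v'.
  apply: eq_bigr => i _; apply: eq_bigr => j _; rewrite /M !ffunE.
  by case: (i \in Y); case: (j \in Y); rewrite /= ?mulr0.
by rewrite eM //; apply: pY.
Qed.

End SumOfSquares.

(** With [n = 2^k] the base is at most [2^(k + a)], and the claim becomes [d (k + a) < 2^k]. *)
Lemma pow_lt_exp a d : exists n : nat, ((a * n).+1 ^ d < 2 ^ n)%N.
Proof.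
pose x := (3 * d + a + 1)%N; pose k := (2 * x)%N.
have lt2 y : (y < 2 ^ y)%N by rewrite ltn_expl.
have hk : (d * (k + a) < 2 ^ k)%N.
  have h : (x * x < 2 ^ k)%N by rewrite /k mul2n -addnn expnD; apply: ltn_mul.
  apply: leq_ltn_trans h; rewrite /k /x; nia.
exists (2 ^ k)%N; apply: leq_ltn_trans (_ : (2 ^ (k + a)) ^ d < _)%N.
  have [->|d0] := posnP d; first by rewrite !expn0.
  rewrite leq_exp2r // expnD mulnC; have := lt2 a; have : (0 < 2 ^ k)%N by rewrite expn_gt0.
  nia.
by rewrite -expnM ltn_exp2l // mulnC.
Qed.

(** * Positive words in a free pair *)

Section PositiveWords.
Variables (S : finType) (m : S -> S -> nat).
Implicit Types (u w : seq S) (e : seq bool).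

Definition positive_word u w e : seq S := flatten [seq (if b : bool then w else u) | b <- e].

Lemma positive_coxeq u u' w w' e : coxeq m u u' -> coxeq m w w' ->
  coxeq m (positive_word u w e) (positive_word u' w' e).
Proof.
move=> hu hw; elim: e => [|b e IH]; first exact: coxeq_refl.
by apply: coxeq_cat => //; case: b.
Qed.

Lemma eval2_positive u w e : eval2 u w [seq (b, false) | b <- e] = positive_word u w e.
Proof. by rewrite /eval2 -map_comp. Qed.

Lemma eval2_negative u w e : eval2 u w [seq (b, true) | b <- rev e] = rev (positive_word u w e).
Proof.
elim: e => // b e IH; rewrite rev_cons map_rcons -cats1 /eval2 map_cat flatten_cat.
by rewrite -/(eval2 _ _ _) IH /= cats0 rev_cat; case: b.
Qed.

Lemma reduced2_opposite b e b' e' : b != b' ->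
  reduced2 ([seq (x, true) | x <- rcons e b] ++ [seq (x, false) | x <- b' :: e']).
Proof.
move=> ne; have pos : reduced2 [seq (x, false) | x <- b' :: e'].
  by elim: e' b' {ne} => //= a e' IH b'; rewrite ?eqxx ?andbF /=; apply: IH.
elim: e => [|a e IH]; first by move: pos; rewrite /= (negbTE ne).
case: e IH => [|a' e] IH; first by rewrite /= ?eqxx ?andbF (negbTE ne); exact: pos.
by rewrite /= ?eqxx ?andbF /=; exact: IH.
Qed.

(** After the common prefix is cancelled, the inverse of one word followed by the other is reduced.
    So a free pair has [2^n] distinct positive products of length [n]. *)
Lemma free_pair_inj u w e e' : free_pair m u w -> size e = size e' ->
  coxeq m (positive_word u w e) (positive_word u w e') -> e = e'.
Proof.
move=> fp; elim: e e' => [|b e IH] [|b' e'] //= [es] h.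
have [eb|ne] := eqVneq b b'.
  by congr (_ :: _) => //; apply: IH => //; move: h; rewrite -eb => /coxeq_cancel.
exfalso; apply: (fp ([seq (x, true) | x <- rev (b :: e)] ++ [seq (x, false) | x <- b' :: e'])).
- by rewrite rev_cons; case: (rev e).
- by rewrite rev_cons; apply: reduced2_opposite.
rewrite /eval2 map_cat flatten_cat -!/(eval2 _ _ _) eval2_negative eval2_positive.
apply: (@coxeq_trans _ _ _ (rev (positive_word u w (b :: e)) ++ positive_word u w (b :: e))).
  by apply: coxeq_catl; apply: coxeq_sym.
exact: coxeq_revKV.
Qed.

End PositiveWords.

(** * Displacements and packing *)

Section Growth.
Variables (R : realType) (S : finType) (m : S -> S -> nat) (B : S -> S -> R).
Hypothesis HB : coxeter_form m B.
Let HC : cartan B := HB.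
Local Notation V := {ffun S -> R}.
Local Notation bform := (bform B).
Local Notation sroot := (sroot R).
Local Notation act := (act B).
Variable Y : pred S.
Hypotheses (hY : closed_part B Y) (pY : psdef B Y).
Implicit Types (v x y : V) (s t : S) (u w : seq S).

(* Represents, through [B], the displacement of [coord_sum] under the dual action; [coord_sum]
   itself need not be represented by a vector when [B] is degenerate. *)
Fixpoint displacement u : V :=
  if u is s :: u' then refl B (sroot s) (displacement u') - scalev 2 (sroot s) else 0.

Lemma coord_sum_sroot s : coord_sum (sroot s) = 1.
Proof.
rewrite /coord_sum (bigD1 s) //= ffunE eqxx big1 ?addr0 // => i ne.
by rewrite ffunE (negbTE ne).
Qed.

Lemma coord_sum_displacement u v : coord_sum (act (rev u) v) = coord_sum v + bform (displacement u) v.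
Proof.
elim: u v => [|s u IH] v; first by rewrite /= bform0l addr0.
rewrite rev_cons act_rcons IH /refl -scaleN1v coord_sumD !coord_sumZ coord_sum_sroot /=.
rewrite /refl -!scaleN1v !(bformE HC) (bformC HC (sroot s) v); ring.
Qed.

Lemma supp_displacement u : all Y u -> supp Y (displacement u).
Proof.
elim: u => [_|s u IH /= /andP[hs hu]]; first exact: supp0.
have ss : supp Y (sroot s) by apply: supp_sroot.
by apply: suppB; [apply: refl_root_supp => //; apply: IH | apply: suppZ].
Qed.

Lemma cauchy_unit x y : supp Y x -> supp Y y -> bform y y = 1 ->
  bform x y ^+ 2 <= bform x x.
Proof.
move=> sx sy ny.
have := pY (suppD sx (suppZ (- bform x y) sy)).
rewrite !(bformE HC) ny (bformC HC y x); lra.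
Qed.

(** Each letter applies an isometry and then subtracts a vector of norm 2. *)
Lemma displacement_size u : all Y u -> bform (displacement u) (displacement u) <= ((2 * size u)%N%:R) ^+ 2.
Proof.
elim: u => [_|s u IH /= /andP[hs hu]]; first by rewrite bform0l sqr_ge0.
have sd := supp_displacement hu; have ss : supp Y (sroot s) by apply: supp_sroot.
have n1 := bform_rootrr HC s.
have := cauchy_unit sd ss n1; have := IH hu.
rewrite !(bformE HC) n1 (bformC HC (sroot s) (displacement u)) mulnS natrD.
have := ler0n R (2 * size u)%N; move: ((2 * size u)%N%:R : R) => k.
move: (bform (displacement u) (displacement u)) (bform (displacement u) (sroot s)) => a b k0 ka ab.
have : b <= k by rewrite leNgt; apply/negP => lt; nra.
nra.
Qed.

(** Some simple root [a_s] is made negative by [u^-1 w]. Against the unit vector [w a_s], the two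
    displacements differ by the coordinate sum of [u^-1 w a_s], at most [-1], minus that of [a_s],
    which is 1. Cauchy-Schwarz turns this gap of 2 into 4. *)
Lemma displacement_sep u w : all Y u -> all Y w -> ~ coxeq m u w ->
  4 <= bform (displacement u - displacement w) (displacement u - displacement w).
Proof.
move=> hu hw ne.
have ne' : ~ coxeq m (rev u ++ w) [::].
  by move=> /coxeq_cat_nil h; apply: ne; rewrite revK in h; apply: coxeq_sym.
have [s ns] := not_coxeq_nil_nonpos HB ne'.
have hs : s \in Y.
  apply: contraT => hs; have := ns s; rewrite ffunE.
  suff -> : act (rev u ++ w) (sroot s) = sroot s.
    by rewrite ffunE eqxx oppr_ge0 ler10.
  have : all Y (rev u ++ w) by rewrite all_cat all_rev hu.
  elim: (rev u ++ w) => //= a l IH /andP[ha hl]; rewrite IH // refl_fix //.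
  by rewrite bform_sroot (cartan_sym HC) hY.
have sr : supp Y (act w (sroot s)) by apply: supp_act => //; apply: supp_sroot.
have t1 : 1 <= coord_sum (- act (rev u ++ w) (sroot s)).
  by apply: (coord_sum_ge1 HB) => //; rewrite !(bformE HC) opprK bform_act // bform_rootrr.
have e1 := coord_sum_displacement u (act w (sroot s)); have e2 := coord_sum_displacement w (act w (sroot s)).
rewrite (actK HC) coord_sum_sroot in e2.
rewrite -scaleN1v coord_sumZ act_cat in t1.
have h : bform (displacement u - displacement w) (act w (sroot s)) <= - 2 by rewrite bformBl; lra.
have n1 : bform (act w (sroot s)) (act w (sroot s)) = 1 by rewrite bform_act // bform_rootrr.
have := cauchy_unit (suppB (supp_displacement hu) (supp_displacement hw)) sr n1.
by apply: le_trans; nra.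
Qed.

(** The form is a sum of [d] squares of functionals; the code rounds [D] times each of them, shifted
    by [D K] to be nonnegative. Equal codes leave at most [d / D < 1], below the separation 4. The
    number of codes is polynomial in [K]. *)
Lemma packing : exists d D : nat, forall K : nat,
  exists code : seq S -> {ffun 'I_d -> 'I_(2 * D * K).+1},
  forall u w, all Y u -> all Y w ->
    bform (displacement u) (displacement u) <= K%:R ^+ 2 -> bform (displacement w) (displacement w) <= K%:R ^+ 2 ->
    code u = code w -> coxeq m u w.
Proof.
have [L eL] := psdef_sum_of_squares HC pY.
pose d := size L; pose D := d.+1; exists d, D => K.
pose val u k := D%:R * dot (nth 0 L k) (displacement u) + (D * K)%N%:R.
exists (fun u => [ffun k : 'I_d => inord (Num.truncn (val u k))]) => u w hu hw qu qw ecode.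
have dot_le x (k : 'I_d) : supp Y x -> dot (nth 0 L k) x ^+ 2 <= bform x x.
  move=> sx; rewrite eL // (big_nth 0) big_mkord (bigD1 k) //= lerDl.
  by apply: sumr_ge0 => i _; apply: sqr_ge0.
have val_itv (x : seq S) (k : 'I_d) : all Y x -> bform (displacement x) (displacement x) <= K%:R ^+ 2 ->
    0 <= val x k <= (2 * D * K)%N%:R.
  move=> hx qx; have := le_trans (dot_le _ k (supp_displacement hx)) qx.
  move=> q1; have : `|dot (nth 0 L k) (displacement x)| <= K%:R.
    by rewrite -(@ler_pXn2r _ 2) ?nnegrE // real_normK ?num_real.
  rewrite ler_norml /val !natrM => /andP[l1 l2].
  have D0 : 0 <= D%:R :> R by apply: ler0n.
  apply/andP; split; nra.
apply: contrapT => /(displacement_sep hu hw); apply/negP; rewrite -ltNge.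
have sd := suppB (supp_displacement hu) (supp_displacement hw).
rewrite eL // (big_nth 0) big_mkord.
have small (k : 'I_d) : dot (nth 0 L k) (displacement u - displacement w) ^+ 2 <= (D%:R)^-1.
  have /andP[u0 u1] := val_itv u k hu qu; have /andP[w0 w1] := val_itv w k hw qw.
  have lt (x : seq S) : val x k <= (2 * D * K)%N%:R -> 0 <= val x k ->
      (Num.truncn (val x k) < (2 * D * K).+1)%N.
    by move=> h1 h0; rewrite truncn_lt_nat //; apply: le_lt_trans h1 _; rewrite ltr_nat.
  have e : Num.truncn (val u k) = Num.truncn (val w k).
    have := congr1 (fun f : {ffun 'I_d -> 'I_(2 * D * K).+1} => nat_of_ord (f k)) ecode.
    by rewrite !ffunE !inordK ?lt.
  have /andP[iu1 iu2] := truncn_itv u0; have /andP[iw1 iw2] := truncn_itv w0.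
  rewrite e -natr1 in iu1 iu2; rewrite -natr1 in iw2.
  rewrite -scaleN1v dotDr dotZr mulN1r.
  have D0 : 0 < D%:R :> R by rewrite ltr0n.
  have D1 : 1 <= D%:R :> R by rewrite ler1n.
  move: iu1 iu2 iw1 iw2; rewrite /val.
  move: (dot _ _) (dot _ _) (D%:R : R) D0 D1 => a b D' D0 D1 a1 a2 c1 c2.
  have h1 : D' * (a - b) < 1 by lra.
  have h2 : -1 < D' * (a - b) by lra.
  have h3 : D' ^+ 2 * (a - b) ^+ 2 <= 1 by nra.
  rewrite -[D'^-1]mul1r ler_pdivlMr //; nra.
apply: le_lt_trans (ler_sum _ (fun k _ => small k)) _.
rewrite sumr_const card_ord -[X in X < _]mulr_natl.
have D0 : 0 < D%:R :> R by rewrite ltr0n.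
rewrite ltr_pdivrMr //; have : d%:R <= D%:R :> R by rewrite ler_nat.
lra.
Qed.

(** The [2^n] positive words of length [n] have displacements of norm at most [2 N n], hence would
    need [2^n] codes among polynomially many. *)
Lemma psd_narrow (H : seq S -> Prop) : sub_parabolic m H [in Y] -> narrow m H.
Proof.
move=> hsub [u [w [/hsub[u' [yu uu']] /hsub[w' [yw ww']] fp]]].
have hu : all Y u' by apply/allP.
have hw : all Y w' by apply/allP.
pose N := maxn (size u') (size w').
have EY e : all Y (positive_word u' w' e).
  by elim: e => //= b e IH; rewrite all_cat IH; case: b; rewrite ?hu ?hw.
have Esize e : (size (positive_word u' w' e) <= N * size e)%N.
  elim: e => [|b e IH] //=; rewrite size_cat mulnS; apply: leq_add => //.
  by case: b; rewrite ?leq_maxr ?leq_maxl.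
have [d [D hp]] := packing; have [n hn] := pow_lt_exp (4 * D * N) d.
have [code hcode] := hp (2 * (N * n))%N.
have inj : injective (fun e : n.-tuple bool => code (positive_word u' w' e)).
  move=> e e' /hcode h; apply/val_inj/(free_pair_inj fp); first by rewrite !size_tuple.
  have q (f : n.-tuple bool) : bform (displacement (positive_word u' w' f)) (displacement (positive_word u' w' f))
      <= (2 * (N * n))%N%:R ^+ 2.
    apply: le_trans (displacement_size (EY f)) _.
    rewrite ler_sqr ?nnegrE // ler_nat leq_mul2l /=.
    by have := Esize f; rewrite size_tuple.
  have := h (EY e) (EY e') (q e) (q e') => {}h.
  have pc f := positive_coxeq f uu' ww'.
  exact: (coxeq_trans (pc _) (coxeq_trans h (coxeq_sym (pc _)))).
have := leq_card _ inj; rewrite card_tuple card_bool card_ffun !card_ord leqNgt.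
by move/negP; apply; move: hn; rewrite (_ : 2 * D * (2 * (N * n)) = 4 * D * N * n)%N //; lia.
Qed.

(** In the definite case the coordinate sum on [Y] is represented by a vector [p], so displacements
    are [u p - p] and stay bounded: one representative per code suffices. *)
Lemma pd_finite (H : seq S -> Prop) : pdef B Y -> sub_parabolic m H [in Y] -> finite_sub m H.
Proof.
move=> pdY hsub.
have subY : {subset [in enum Y] <= Y} by move=> i; rewrite -[i \in Y]mem_enum.
have [p [sp hp]] := pdef_solve HC (enum_uniq Y) (pdef_sub subY pdY) (fun _ => 1).
have {}sp : supp Y p by apply: supp_sub sp.
have dispE u : all Y u -> displacement u = act u p - p.
  elim: u => [|s u IH] /=; first by rewrite subrr.
  move=> /andP[hs hu]; rewrite IH //; have := hp s; rewrite mem_enum => /(_ hs) e.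
  by apply/ffunP => i; rewrite /refl bformBl e !ffunE; ring.
have [K hK] : exists K : nat, 4 * bform p p <= K%:R ^+ 2.
  exists (Num.bound (4 * bform p p)); have q0 : 0 <= 4 * bform p p by rewrite mulr_ge0 // pY.
  have := archi_boundP q0; move: (Num.bound _) => [|n] lt; first by have := le_lt_trans q0 lt; rewrite ltxx.
  apply: le_trans (ltW lt) _; rewrite expr2; apply: ler_peMr => //.
  by rewrite ler1n.
have disp_le u : all Y u -> bform (displacement u) (displacement u) <= K%:R ^+ 2.
  move=> hu; apply: le_trans hK; rewrite dispE //.
  have := pY (suppD (supp_act u hY sp) sp).
  rewrite !(bformE HC) !bform_act // (bformC HC p (act u p)); lra.
have [d [D hpack]] := packing; have [code hcode] := hpack K.
pose good c u := all Y u /\ code u = c.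
have [rep hrep] : exists rep : {ffun 'I_d -> 'I_(2 * D * K).+1} -> seq S,
    forall c, (exists u, good c u) -> good c (rep c).
  apply: (@fin_all_exists _ _ (fun c r => (exists u, good c u) -> good c r)) => c.
  by have [[u hu]|no] := pselect (exists u, good c u); [exists u | exists [::]].
exists [seq rep c | c <- enum {ffun 'I_d -> 'I_(2 * D * K).+1}] => u /hsub[v [yv uv]].
exists (rep (code v)); first by apply: map_f; rewrite mem_enum.
have hv : all Y v by apply/allP.
have [yr er] : good (code v) (rep (code v)) by apply: hrep; exists v.
apply: coxeq_trans uv _; apply: hcode => //; exact: disp_le.
Qed.

End Growth.

(** * The canonical form *)

#[local] Arguments sin x%_ring_scope.
#[local] Arguments cos x%_ring_scope.

Lemma cheb_sin (th : R) k : cheb (cos th) k * sin th = sin (k%:R * th).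
Proof.
have sinD (a b : R) : sin (a + b) = sin a * cos b + cos a * sin b := sin_plus a b.
have sinB (a b : R) : sin (a - b) = sin a * cos b - cos a * sin b := sin_minus a b.
have [n] := ubnP k; elim: n k => // n IH [|[|k]] /ltnSE lt.
- by rewrite cheb0 !mul0r; have -> : sin 0 = 0 := sin_0.
- by rewrite cheb1 !mul1r.
rewrite chebSS mulrBl -(mulrA (2 * cos th)) IH // IH 1?ltnW //.
have -> : k.+2%:R * th = k.+1%:R * th + th by rewrite -[k.+2%:R]natr1; ring.
have -> : k%:R * th = k.+1%:R * th - th by rewrite -natr1; ring.
by rewrite sinB sinD; ring.
Qed.

Section Cosine.
Variables (n : nat).
Hypothesis n2 : (2 <= n)%N.
Let th : R := PI / n%:R.

Let n0 : 0 < n%:R :> R. Proof. by rewrite ltr0n; lia. Qed.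
Let pi0 : 0 < PI :> R. Proof. exact/RltP/PI_RGT_0. Qed.
Let th0 : 0 < th. Proof. by rewrite divr_gt0. Qed.
Let th_half : th <= PI / 2.
Proof.
rewrite ler_pdivrMr // mulrAC ler_pdivlMr //; apply: ler_wpM2l; first exact: ltW.
by rewrite ler_nat.
Qed.

Lemma sin_angle_gt0 : 0 < sin th.
Proof.
apply/RltP/sin_gt_0; apply/RltP => //; rewrite -[PI]/(PI : R).
by apply: le_lt_trans th_half _; rewrite ltr_pdivrMr // mulr_natr mulr2n ltrDl.
Qed.

Let two : IZR 2 = 2%:R. Proof. by rewrite -INRE INR_IZR_INZ. Qed.
Let half_pi : Rdiv PI (IZR 2) = PI / 2.
Proof. by rewrite RdivE two. Qed.

Lemma cos_angle_ge0 : 0 <= cos th.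
Proof.
apply/RleP/cos_ge_0; rewrite half_pi; apply/RleP => //.
apply: (@le_trans _ _ 0); last exact: ltW.
by rewrite oppr_le0 divr_ge0 // ltW.
Qed.

Lemma cos_angle_gt0 : (2 < n)%N -> 0 < cos th.
Proof.
move=> n3; apply/RltP/cos_gt_0; rewrite half_pi; apply/RltP.
  apply: (@lt_trans _ _ 0) => //; by rewrite oppr_lt0 divr_gt0.
rewrite ltr_pdivrMr // mulrAC ltr_pdivlMr //.
by rewrite ltr_pM2l // ltr_nat.
Qed.

Lemma cos_angle_sqr_lt1 : cos th ^+ 2 < 1.
Proof.
have e : sin th ^+ 2 + cos th ^+ 2 = 1 by rewrite !expr2; exact: sin2_cos2.
have := sin_angle_gt0; nra.
Qed.

Let n_th : n%:R * th = PI. Proof. by rewrite /th mulrC divfK // gt_eqF. Qed.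

Let sin0 : sin th != 0. Proof. by rewrite gt_eqF // sin_angle_gt0. Qed.

Let two_pi : (n + n)%N%:R * th = Rmult (IZR 2) PI.
Proof. by rewrite natrD mulrDl n_th RmultE two; ring. Qed.

Lemma cheb_angle0 : cheb (cos th) (n + n) = 0.
Proof.
by apply: (mulIf sin0); rewrite mul0r cheb_sin two_pi; apply: sin_2PI.
Qed.

Lemma cheb_angle1 : cheb (cos th) (n + n).+1 = 1.
Proof.
apply: (mulIf sin0); rewrite mul1r cheb_sin -natr1 mulrDl mul1r two_pi.
rewrite -RplusE sin_plus sin_2PI cos_2PI.
by rewrite Rmult_0_l Rmult_1_l Rplus_0_l.
Qed.

Lemma cheb_angle_ge0 k : (k <= n)%N -> 0 <= cheb (cos th) k.
Proof.
move=> le; rewrite -(pmulr_lge0 _ sin_angle_gt0) cheb_sin; apply/RleP/sin_ge_0; apply/RleP.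
  by rewrite mulr_ge0 // ltW.
by rewrite -[leRHS]n_th; apply: ler_wpM2r; [exact: ltW | rewrite ler_nat].
Qed.

End Cosine.

Section CanonicalForm.
Variables (S : finType) (m : S -> S -> nat).
Hypothesis hm : coxeter_matrix m.
Local Notation B := (cform m).

Let m_ge2 s t : s != t -> m s t != 0%N -> (2 <= m s t)%N.
Proof. by case: hm => _ _ /(_ s t) h /h; lia. Qed.

Lemma cform_infinite s t : m s t = 0%N -> B s t = -1.
Proof. by move=> e; rewrite /cform e eqxx. Qed.

Lemma cform_finite s t : m s t != 0%N -> B s t = - cos (PI / (m s t)%:R).
Proof. by move=> /negbTE h; rewrite /cform h INRE RdivE. Qed.

Lemma cheb_1 (K : realType) k : cheb (1 : K) k = k%:R.
Proof.
have [n] := ubnP k; elim: n k => // n IH [|[|k]] /ltnSE lt //.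
by rewrite chebSS !IH // 1?ltnW // -[k.+2]addn2 -[k.+1]addn1 !natrD; ring.
Qed.

Lemma coxeter_form_cform : coxeter_form m B.
Proof.
case: (hm) => m1 mC _; split; first split.
- by move=> s t; rewrite /cform mC.
- move=> s; rewrite cform_finite m1 // divr1.
  by rewrite (cos_PI : cos PI = -1) opprK.
- move=> s t ne; have [e|h] := eqVneq (m s t) 0%N; first by rewrite cform_infinite // lerN10.
  by rewrite cform_finite // oppr_le0 cos_angle_ge0 // m_ge2.
- move=> s t; have [e|h] := eqVneq (m s t) 0%N; first by rewrite cform_infinite.
  by rewrite cform_finite // lerN2; apply/RleP; case: (COS_bound (PI / (m s t)%:R)).
- by [].
- by [].
- by move=> s t ne h; rewrite cform_finite // sqrrN cos_angle_sqr_lt1 // m_ge2.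
- by move=> s t ne h; rewrite cform_finite // opprK cheb_angle0 // m_ge2.
- by move=> s t ne h; rewrite cform_finite // opprK cheb_angle1 // m_ge2.
move=> s t k ne; have [e _|h /(_ isT) le] := eqVneq (m s t) 0%N.
  by rewrite cform_infinite // opprK cheb_1.
by rewrite cform_finite // opprK cheb_angle_ge0 // m_ge2.
Qed.

Let HB := coxeter_form_cform.
Let HC : cartan B := HB.

Lemma cgraphP s t : s != t -> if cgraph m s t then is_true (B s t < 0) else B s t = 0.
Proof.
move=> ne; rewrite /cgraph ne /=; case: eqVneq => [e|h] /=.
  by rewrite cform_finite e // -RdivE (_ : 2%:R = IZR 2) ?cos_PI2 ?oppr0 // -INRE INR_IZR_INZ.
have [e|h'] := eqVneq (m s t) 0%N; first by rewrite cform_infinite // ltrN10.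
rewrite cform_finite // oppr_lt0 cos_angle_gt0 //; first exact: m_ge2.
by have := m_ge2 ne h'; lia.
Qed.

Lemma cgraph_sym : symmetric (cgraph m).
Proof. by case: hm => _ mC _ s t; rewrite /cgraph eq_sym mC. Qed.

Lemma comp_closed s : closed_part B (Defs.comp m s).
Proof.
move=> i j; rewrite !unfold_in => hi hj.
have ne : i != j by apply: contraNneq hj => <-.
have := cgraphP ne; case: ifP => // e; case/negP: hj.
exact: connect_trans hi (connect1 e).
Qed.

Lemma comp_conn s : conn_part B (Defs.comp m s).
Proof.
move=> P [a ha Pa] step t; rewrite !unfold_in in ha * => ht.
have /connectP[p hp ->] : connect (cgraph m) a t.
  by rewrite (connect_trans _ ht) // (sym_connect_sym cgraph_sym).
elim: p a ha Pa hp => //= b p IH a ha Pa /andP[ab hp].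
have hb : connect (cgraph m) s b := connect_trans ha (connect1 ab).
have ne : a != b by case/andP: ab.
by apply: IH => //; apply: (step a b) => //; have := cgraphP ne; rewrite ab.
Qed.

Lemma comp_refl s : s \in Defs.comp m s.
Proof. exact: connect0. Qed.

Lemma qform_restrict X (x : S -> R) :
  qform m X x = bform B [ffun i => if i \in X then x i else 0] [ffun i => if i \in X then x i else 0].
Proof.
rewrite /qform /bform big_mkcond; apply: eq_bigr => i _; rewrite ffunE.
case: ifP => hi; last by rewrite big1 // => j _; rewrite !mul0r.
by rewrite big_mkcond; apply: eq_bigr => j _; rewrite ffunE; case: ifP; rewrite ?mulr0 ?mul0r.
Qed.

Lemma restrict_supp X (v : {ffun S -> R}) : supp X v -> [ffun i => if i \in X then v i else 0] = v.
Proof. by move=> sv; apply/ffunP => i; rewrite ffunE; case: ifP => // /negbT/sv. Qed.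

Lemma pos_defP X : pos_def m X <-> pdef B X.
Proof.
split=> h.
  move=> v sv v0; have := h v; rewrite qform_restrict restrict_supp //; apply.
  apply: contrapT => no; case/eqP: v0; apply/ffunP => i; rewrite ffunE; apply/eqP.
  apply: contraT => vi; case: no; exists i => //.
  by apply: contraT => hi; rewrite sv ?eqxx in vi.
move=> x [t ht xt]; rewrite qform_restrict; apply: h.
  by move=> i /negbTE hi; rewrite ffunE hi.
by apply: (@vec_neq0 _ _ _ t); rewrite ffunE ht.
Qed.

Lemma pos_semidefP X : pos_semidef m X <-> psdef B X.
Proof.
split=> h; first by move=> v sv; have := h v; rewrite qform_restrict restrict_supp.
by move=> x; rewrite qform_restrict; apply: h => i /negbTE hi; rewrite ffunE hi.
Qed.

Lemma comp_eq s t : t \in Defs.comp m s -> Defs.comp m s = Defs.comp m t.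
Proof.
move=> h; apply/funext => i; rewrite /Defs.comp.
exact: (same_connect (sym_connect_sym cgraph_sym)).
Qed.

Section Union.
Variables (Y : pred S).
Hypothesis hY : forall s t, s \in Y -> t \in Defs.comp m s -> t \in Y.

Lemma union_closed : closed_part B Y.
Proof.
move=> i j hi hj; apply: (comp_closed (comp_refl i)).
by apply: contra hj; apply: hY.
Qed.

Let piece (v : {ffun S -> R}) s : {ffun S -> R} :=
  [ffun i => if i \in Defs.comp m s then v i else 0].

Let supp_piece v s : supp (Defs.comp m s) (piece v s).
Proof. by move=> i /negbTE hi; rewrite ffunE hi. Qed.

(** Distinct components are orthogonal. Here [fingraph.roots] means one chosen vertex per component,
    not roots of the Coxeter group. *)
Let bform_pieces v : bform B v v =
  \sum_(k | k \in fingraph.roots (cgraph m)) bform B (piece v k) (piece v k).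
Proof.
have cs := sym_connect_sym cgraph_sym.
have orth s : bform B (piece v s) v = bform B (piece v s) (piece v s).
  rewrite -[X in bform B _ X](subrK (piece v s)) (bformDr HC) addrC -[RHS]addr0; congr (_ + _).
  have sp : supp (Defs.comp m s) (piece v s) by apply: supp_piece.
  apply: (bform_orth sp) => i hi.
  rewrite (bformC HC) bformEl big1 // => j _; rewrite bform_sroot !ffunE.
  case: ifP => [_|/negbT hj]; first by rewrite subrr mul0r.
  by rewrite (cartan_sym HC) (comp_closed hi hj) mulr0.
rewrite [LHS]bformEl (partition_big (fingraph.root (cgraph m)) [in fingraph.roots (cgraph m)]) /=; last first.
  by move=> i _; exact: (roots_root cs).
apply: eq_bigr => k hk; rewrite -orth bformEl big_mkcond; apply: eq_bigr => i _.
rewrite ffunE unfold_in /Defs.comp /= -(root_connect cs) (eqP hk) eq_sym.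
by case: ifP; rewrite ?mul0r.
Qed.

Let piece_in v k i : supp Y v -> piece v k i != 0 -> i \in Y /\ Defs.comp m k = Defs.comp m i.
Proof.
move=> sv; rewrite ffunE; case: ifP => [hi vi|_]; last by rewrite eqxx.
split; last exact: comp_eq.
by apply: contraT => hi'; rewrite sv ?eqxx in vi.
Qed.

Lemma union_psdef : (forall s, s \in Y -> psdef B (Defs.comp m s)) -> psdef B Y.
Proof.
move=> h v sv; rewrite bform_pieces; apply: sumr_ge0 => k _.
have [->|ne] := eqVneq (piece v k) 0; first by rewrite bform0l.
have [i vi] := vec_neq0_ex ne.
have [hi e] := piece_in sv vi; have := h i hi; rewrite -e; apply; exact: supp_piece.
Qed.

Lemma union_pdef : (forall s, s \in Y -> pdef B (Defs.comp m s)) -> pdef B Y.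
Proof.
move=> h v sv v0.
have pc k : piece v k != 0 -> 0 < bform B (piece v k) (piece v k).
  move=> ne; have [i vi] := vec_neq0_ex ne.
  have [hi e] := piece_in sv vi; have := h i hi; rewrite -e; apply => //; exact: supp_piece.
have [i vi] := vec_neq0_ex v0.
have cs := sym_connect_sym cgraph_sym.
rewrite bform_pieces (bigD1 (fingraph.root (cgraph m) i)) ; last exact: (roots_root cs).
apply: ltr_pwDl.
  apply: pc; apply: (@vec_neq0 _ _ _ i); rewrite ffunE unfold_in /Defs.comp.
  by rewrite cs connect_root.
apply: sumr_ge0 => k _; have [->|ne] := eqVneq (piece v k) 0; first by rewrite bform0l.
exact/ltW/pc.
Qed.

(** Deleting from [u] the letters outside [Y] changes nothing on the span of [Y]; on the other
    simple roots both words act trivially. Faithfulness concludes. *)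
Lemma sub_parabolic_trivial (H : seq S -> Prop) :
  (forall h s, H h -> s \notin Y -> act B h (sroot _ s) = sroot _ s) ->
  sub_parabolic m H [in Y].
Proof.
move=> h u Hu; exists (filter Y u); split; first by move=> s; rewrite mem_filter => /andP[].
apply: coxeq_trans (_ : coxeq m u (filter Y u ++ [::])) _; last by rewrite cats0; exact: coxeq_refl.
have : coxeq m (rev (filter Y u) ++ u) [::].
  apply: (act_faithful HB) => s; rewrite act_cat; have [hs|hs] := boolP (s \in Y).
    by rewrite -(act_filter u union_closed) ?(actK HC) //; apply: supp_sroot.
  rewrite h //; have : all Y (rev (filter Y u)) by rewrite all_rev filter_all.
  elim: (rev _) => //= a l IH /andP[ha hl]; rewrite IH // refl_fix //.
  by rewrite bform_sroot (cartan_sym HC) union_closed.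
by move=> /coxeq_cat_nil; rewrite revK cats0.
Qed.

End Union.

End CanonicalForm.

Theorem theorem3p4 (S : finType) (m : S -> S -> nat)
  (hm : coxeter_matrix m) (H : seq S -> Prop) (hH : normal_subgroup m H) :
  (finite_sub m H <-> sub_parabolic m H (is_sph m)) /\
  (narrow m H <-> sub_parabolic m H (fun s => is_aff m s \/ is_sph m s)).
Proof.
have HB := coxeter_form_cform hm; have HC : cartan (cform m) := HB.
pose Yof (P : S -> Prop) : pred S := fun s => `[< P s >].
have YofP P s : reflect (P s) (s \in Yof P) by apply: asboolP.
have subY P : sub_parabolic m H P <-> sub_parabolic m H [in Yof P].
  by split=> h u /h[v [hv e]]; exists v; split => // s /hv /YofP.
split; rewrite subY; split.
- move=> [l hl]; apply: (sub_parabolic_trivial hm).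
    by move=> s t /YofP hs ht; apply/YofP; rewrite /is_sph -(comp_eq hm ht).
  move=> h s Hh /YofP ns.
  have np : ~ pdef (cform m) (Defs.comp m s) by move/pos_defP.
  have [z [sz pz hz]] := nonspherical_vec HC (@comp_closed _ _ hm s) (@comp_conn _ _ hm s) np.
  apply: (finite_image_trivial HB hH (@comp_closed _ _ hm s) (@comp_conn _ _ hm s) sz pz hz (l := l)) => //.
    by move=> h' /hl[w wl e]; exists w => // t _; exact: (act_coxeq HB).
  exact: comp_refl.
- have cl : forall s t, s \in Yof (is_sph m) -> t \in Defs.comp m s -> t \in Yof (is_sph m).
    by move=> s t /YofP hs ht; apply/YofP; rewrite /is_sph -(comp_eq hm ht).
  have pd : pdef (cform m) (Yof (is_sph m)).
    by apply: (union_pdef hm) => s /YofP/pos_defP.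
  apply: (pd_finite HB (union_closed hm cl)) => //.
  by move=> v sv; have [->|v0] := eqVneq v 0; [rewrite bform0l | exact/ltW/pd].
- move=> nar; apply: (sub_parabolic_trivial hm).
    move=> s t /YofP hs ht; apply/YofP; rewrite /is_sph /is_aff -(comp_eq hm ht); exact: hs.
  move=> h s Hh /YofP ns.
  have np : ~ psdef (cform m) (Defs.comp m s).
    move/pos_semidefP => h1; apply: ns; have [h2|h2] := EM (is_sph m s); first by right.
    by left.
  have [z [sz pz hz]] := generic_vec HC (@comp_closed _ _ hm s) (@comp_conn _ _ hm s) np.
  apply/eqP; apply: contraT => ne; case: (generic_not_narrow HB hH
    (@comp_closed _ _ hm s) (@comp_conn _ _ hm s) sz pz hz _ nar).
  by exists h, s; split => //; apply: comp_refl.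
- have cl : forall s t, s \in Yof (fun s => is_aff m s \/ is_sph m s) -> t \in Defs.comp m s ->
      t \in Yof (fun s => is_aff m s \/ is_sph m s).
    move=> s t /YofP hs ht; apply/YofP; rewrite /is_sph /is_aff -(comp_eq hm ht); exact: hs.
  apply: (psd_narrow HB (union_closed hm cl)).
  apply: (union_psdef hm) => s /YofP[[/pos_semidefP //]|/pos_defP pd].
  by move=> v sv; have [->|v0] := eqVneq v 0; [rewrite bform0l | exact/ltW/pd].
Qed.
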